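(* Assume the following. (1) For all $V$-relations $r:X\nrightarrow X'$ and $s:Y\nrightarrow Y'$, $\mathrm{can}_{X',Y'}\cdot T(r\boxtimes s)=\big((Tr)\boxtimes(Ts)\big)\cdot \mathrm{can}_{X,Y}$. (2) For all $u,v,w\in V$, $w\wedge(u\otimes v)=\bigvee\{u'\otimes v'\mid u'\le u,\ v'\le v,\ u'\otimes v'\le w\}$. (3) For every $V$-relation $a:X\nrightarrow Y$ and every $u\in V$, $T(a\otimes u)=Ta\otimes u$, where $(a\otimes u)(x,y)=a(x,y)\otimes u$ (and likewise for $Ta\otimes u$). (4) The map $\otimes:V\otimes V\to V$ and, for every $(\mathbb{T},V)$-category $X$ and every $u\in V$, the map $(-,u):X\to X\otimes V$, $x\mapsto(x,u)$, are $(\mathbb{T},V)$-functors, where $V$ carries the structure $\hom_\xi$. Then the exact completion of the category $(\mathbb{T},V)\text{-}\mathbf{Cat}$ is cartesian closed.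
   Context: $V$ is a commutative unital quantale: a complete lattice with a commutative associative operation $\otimes$ with unit $k$ such that each $u\otimes-$ has a right adjoint $\hom(u,-)$. Moreover $V$ is a Heyting algebra (each $u\wedge-$ has a right adjoint). A $V$-relation $r:X\nrightarrow Y$ is a map $r:X\times Y\to V$; $V$-relations are ordered pointwise, composed by $(s\cdot r)(x,z)=\bigvee_y r(x,y)\otimes s(y,z)$. A map $f:X\to Y$ is regarded as the $V$-relation with value $k$ at $(x,f(x))$ and $\bot$ elsewhere. $V\text{-}\mathbf{Rel}$ is the resulting 2-category. $\mathbb{T}=(T,m,e)$ is a non-trivial monad on $\mathbf{Set}$ (it has an algebra with at least two elements; equivalently, all $e_X$ are injective) such that $T$ preserves weak pullbacks and the naturality squares of $m$ are weak pullbacks. The extension of $\mathbb{T}$ to $V\text{-}\mathbf{Rel}$ is given by a strict topological theory: a map $\xi:TV\to V$ such that (i) $(V,\xi)$ is an Eilenberg–Moore algebra for $\mathbb{T}$; (ii) $\otimes:V\times V\to V$ and $k:1\to V$ are $\mathbb{T}$-homomorphisms, i.e. $\xi\cdot T(\otimes)=\otimes\cdot\langle\xi\cdot T\pi_1,\xi\cdot T\pi_2\rangle$ and $\xi\cdot Tk=k\cdot !$; (iii) the maps $\xi_X:V^X\to V^{TX}$, $\varphi\mapsto\xi\cdot T\varphi$, are monotone and form a natural transformation $P_V\to P_VT$, where $P_V(X)=V^X$ and, for $f:X\to Y$, $P_V(f)(\varphi)(y)=\bigvee_{f(x)=y}\varphi(x)$. For a $V$-relation $r:X\times Y\to V$,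 $Tr:TX\nrightarrow TY$ is defined by $Tr(\mathfrak{x},\mathfrak{y})=\bigvee\{\xi\cdot Tr(\mathfrak{w})\mid\mathfrak{w}\in T(X\times Y),T\pi_X(\mathfrak{w})=\mathfrak{x},T\pi_Y(\mathfrak{w})=\mathfrak{y}\}$ (on the right, $Tr:T(X\times Y)\to TV$ is the $\mathbf{Set}$-functor $T$ applied to the map $r$). A $(\mathbb{T},V)$-category is a pair $(X,a)$ with $a:TX\nrightarrow X$ a $V$-relation such that $k\le a(e_X(x),x)$ and $Ta(\mathfrak{X},\mathfrak{x})\otimes a(\mathfrak{x},x)\le a(m_X(\mathfrak{X}),x)$ for all $\mathfrak{X}\in TTX$, $\mathfrak{x}\in TX$, $x\in X$. A $(\mathbb{T},V)$-functor $f:(X,a)\to(Y,b)$ is a map with $a(\mathfrak{x},x)\le b(Tf(\mathfrak{x}),f(x))$ for all $\mathfrak{x},x$. They form the category $(\mathbb{T},V)\text{-}\mathbf{Cat}$, which is complete. The tensor product is $(X,a)\otimes(Y,b)=(X\times Y,c)$ with $c(\mathfrak{w},(x,y))=a(T\pi_X(\mathfrak{w}),x)\otimes b(T\pi_Y(\mathfrak{w}),y)$; it is a $(\mathbb{T},V)$-category in this setting. $V$ is a $(\mathbb{T},V)$-category with structure $\hom_\xi=\hom\cdot\xi$, i.e. $\hom_\xi(\mathfrak{v},v)=\hom(\xi(\mathfrak{v}),v)$. $\mathrm{can}_{X,Y}:T(X\times Y)\to TX\times TY$ is $\mathfrak{w}\mapsto(T\pi_X(\mathfrak{w}),T\pi_Y(\mathfrak{w}))$.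 For $r:X\nrightarrow X'$, $s:Y\nrightarrow Y'$, $r\boxtimes s:X\times Y\nrightarrow X'\times Y'$ is $(r\boxtimes s)((x,y),(x',y'))=r(x,x')\wedge s(y,y')$. The exact completion $\mathbf{C}_{\mathrm{ex}}$ of a category $\mathbf{C}$ with finite limits is the free (Barr-)exact category on the finitely complete category $\mathbf{C}$. *)

(* Defs.v *)
From HB Require Import structures.
From mathcomp Require Import all_boot all_order.
From mathcomp Require Import boolp classical_sets.

Set Implicit Arguments.
Unset Strict Implicit.
Unset Printing Implicit Defensive.

Import Order.TTheory.
Local Open Scope classical_set_scope.

(** * Categories *)

(* Hom-types carry Leibniz equality. *)
Record category := Category {
  cobj :> Type;
  chom : cobj -> cobj -> Type;
  cid : forall X, chom X X;
  ccomp : forall X Y Z, chom Y Z -> chom X Y -> chom X Z;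
  ccompA : forall W X Y Z (h : chom Y Z) (g : chom X Y) (f : chom W X),
    ccomp h (ccomp g f) = ccomp (ccomp h g) f;
  ccomp1l : forall X Y (f : chom X Y), ccomp (cid Y) f = f;
  ccomp1r : forall X Y (f : chom X Y), ccomp f (cid X) = f
}.
Arguments chom {c} X Y.
Arguments cid {c} X.
Arguments ccomp {c X Y Z} g f.

Notation "g \co f" := (ccomp g f) (at level 50, left associativity).

Section Limits.
Variable C : category.
Implicit Types X Y Z P Q W : C.

Definition is_terminal X := forall Y, exists! f : chom Y X, True.

Definition is_product X Y P (p : chom P X) (q : chom P Y) :=
  forall W (u : chom W X) (v : chom W Y),
    exists! h : chom W P, p \co h = u /\ q \co h = v.

Definition is_pullback X Y Z P (f : chom X Z) (g : chom Y Z)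
    (p : chom P X) (q : chom P Y) :=
  f \co p = g \co q /\
  forall W (u : chom W X) (v : chom W Y), f \co u = g \co v ->
    exists! h : chom W P, p \co h = u /\ q \co h = v.

Definition is_coequalizer X Y Q (f g : chom X Y) (q : chom Y Q) :=
  q \co f = q \co g /\
  forall W (u : chom Y W), u \co f = u \co g ->
    exists! h : chom Q W, h \co q = u.

Definition regular_epi Y Q (q : chom Y Q) :=
  exists X (f g : chom X Y), is_coequalizer f g q.

Definition finitely_complete :=
  (exists X, is_terminal X) /\
  (forall X Y Z (f : chom X Z) (g : chom Y Z),
     exists P (p : chom P X) (q : chom P Y), is_pullback f g p q).

Definition regular_category :=
  [/\ finitely_complete,
      forall X Y P (f : chom X Y) (p q : chom P X), is_pullback f f p q ->
        exists Q (c : chom X Q), is_coequalizer p q c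
    & forall X Y Z P (f : chom X Z) (g : chom Y Z) (p : chom P X) (q : chom P Y),
        is_pullback f g p q -> regular_epi f -> regular_epi q].

Definition equivalence_relation R X (r1 r2 : chom R X) :=
  [/\ forall W (u v : chom W R),
        r1 \co u = r1 \co v -> r2 \co u = r2 \co v -> u = v,
      exists d : chom X R, r1 \co d = cid X /\ r2 \co d = cid X,
      exists s : chom R R, r1 \co s = r2 /\ r2 \co s = r1
    & forall P (p q : chom P R), is_pullback r2 r1 p q ->
        exists t : chom P R, r1 \co t = r1 \co p /\ r2 \co t = r2 \co q].

Definition exact_category :=
  regular_category /\
  (forall R X (r1 r2 : chom R X), equivalence_relation r1 r2 ->
     exists Y (f : chom X Y), is_pullback f f r1 r2).

(* Z, with evaluation ev defined on the product P of Z and X, is an exponential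
   of Y by X. *)
Definition is_exponential X Y Z P (p1 : chom P Z) (p2 : chom P X)
    (ev : chom P Y) :=
  is_product p1 p2 /\
  forall W Q (q1 : chom Q W) (q2 : chom Q X), is_product q1 q2 ->
    forall f : chom Q Y,
      exists! g : chom W Z,
        exists h : chom Q P, [/\ p1 \co h = g \co q1, p2 \co h = q2 & ev \co h = f].

Definition cartesian_closed :=
  [/\ exists X, is_terminal X,
      forall X Y, exists P (p : chom P X) (q : chom P Y), is_product p q
    & forall X Y, exists Z P (p1 : chom P Z) (p2 : chom P X) (ev : chom P Y),
        is_exponential p1 p2 ev].

End Limits.

Record functor (C D : category) := Functor {
  fobj :> C -> D;
  fmap : forall X Y, chom X Y -> chom (fobj X) (fobj Y);
  fmap1 : forall X, fmap (cid X) = cid (fobj X);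
  fmapM : forall X Y Z (g : chom Y Z) (f : chom X Y),
    fmap (g \co f) = fmap g \co fmap f
}.
Arguments fmap {C D} _ {X Y} _.

Section FunctorComp.
Variables (C D E : category) (G : functor D E) (F : functor C D).

Lemma functor_comp_map1 X : fmap G (fmap F (cid X)) = cid (G (F X)).
Proof. by rewrite !fmap1. Qed.

Lemma functor_comp_mapM X Y Z (g : chom Y Z) (f : chom X Y) :
  fmap G (fmap F (g \co f)) = fmap G (fmap F g) \co fmap G (fmap F f).
Proof. by rewrite !fmapM. Qed.

Definition functor_comp : functor C E :=
  @Functor C E (fun X => G (F X)) (fun X Y f => fmap G (fmap F f))
    functor_comp_map1 functor_comp_mapM.

End FunctorComp.

Definition natural (C D : category) (F G : functor C D)
    (t : forall X, chom (F X) (G X)) :=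
  forall X Y (f : chom X Y), t Y \co fmap F f = fmap G f \co t X.

Definition naturally_isomorphic (C D : category) (F G : functor C D) :=
  exists (s : forall X, chom (F X) (G X)) (t : forall X, chom (G X) (F X)),
    [/\ natural s, natural t,
        forall X, t X \co s X = cid (F X) & forall X, s X \co t X = cid (G X)].

Definition lex_functor (C D : category) (F : functor C D) :=
  (forall X, is_terminal X -> is_terminal (F X)) /\
  (forall X Y Z P (f : chom X Z) (g : chom Y Z) (p : chom P X) (q : chom P Y),
     is_pullback f g p q ->
     is_pullback (fmap F f) (fmap F g) (fmap F p) (fmap F q)).

Definition regular_functor (C D : category) (F : functor C D) :=
  lex_functor F /\
  (forall X Y (q : chom X Y), regular_epi q -> regular_epi (fmap F q)).

(* J exhibits E as the free exact category on the finitely complete category C: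
   for every exact category A, precomposition with J is an equivalence from the
   category of regular functors E -> A to the category of lex functors C -> A.
   The last two clauses say that it is essentially surjective, respectively
   fully faithful. *)
Definition is_exact_completion (C E : category) (J : functor C E) :=
  [/\ finitely_complete C, exact_category E, lex_functor J,
      forall A : category, exact_category A ->
        forall F : functor C A, lex_functor F ->
          exists G : functor E A,
            regular_functor G /\ naturally_isomorphic (functor_comp G J) F
    & forall A : category, exact_category A ->
        forall G H : functor E A, regular_functor G -> regular_functor H ->
          forall s : forall X, chom (functor_comp G J X) (functor_comp H J X),
            natural s ->
            exists! t : forall Y, chom (G Y) (H Y),
              natural t /\ forall X, t (J X) = s X].

(** * Monads on the category of sets *)

(* Types play the role of sets and Coq functions that of maps. *)
Record monad := Monad {
  mobj :> Type -> Type;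
  mmap : forall X Y : Type, (X -> Y) -> mobj X -> mobj Y;
  munit : forall X : Type, X -> mobj X;
  mmult : forall X : Type, mobj (mobj X) -> mobj X;
  mmap1 : forall (X : Type) (x : mobj X), mmap (fun z => z) x = x;
  mmapM : forall (X Y Z : Type) (g : Y -> Z) (f : X -> Y) (x : mobj X),
    mmap (fun z => g (f z)) x = mmap g (mmap f x);
  munit_nat : forall (X Y : Type) (f : X -> Y) (x : X),
    mmap f (munit x) = munit (f x);
  mmult_nat : forall (X Y : Type) (f : X -> Y) (x : mobj (mobj X)),
    mmap f (mmult x) = mmult (mmap (mmap f) x);
  mmult_unitl : forall (X : Type) (x : mobj X), mmult (munit x) = x;
  mmult_unitr : forall (X : Type) (x : mobj X), mmult (mmap (@munit X) x) = x;
  mmultA : forall (X : Type) (x : mobj (mobj (mobj X))),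
    mmult (mmult x) = mmult (mmap (@mmult X) x)
}.
Arguments mmap m {X Y} f x.
Arguments munit m {X} x.
Arguments mmult m {X} x.

Definition EM_algebra (T : monad) (X : Type) (alpha : T X -> X) :=
  (forall x : X, alpha (munit T x) = x) /\
  (forall x : T (T X), alpha (mmult T x) = alpha (mmap T alpha x)).

Definition nontrivial_monad (T : monad) :=
  exists (X : Type) (alpha : T X -> X),
    EM_algebra alpha /\ exists x y : X, x <> y.

Definition weak_pullback (X Y Z P : Type) (f : X -> Z) (g : Y -> Z)
    (p : P -> X) (q : P -> Y) :=
  (forall w, f (p w) = g (q w)) /\
  forall (W : Type) (u : W -> X) (v : W -> Y), (forall w, f (u w) = g (v w)) ->
    exists h : W -> P, (forall w, p (h w) = u w) /\ (forall w, q (h w) = v w).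

Definition preserves_weak_pullbacks (T : monad) :=
  forall (X Y Z P : Type) (f : X -> Z) (g : Y -> Z) (p : P -> X) (q : P -> Y),
    weak_pullback f g p q ->
    weak_pullback (mmap T f) (mmap T g) (mmap T p) (mmap T q).

Definition mult_weakly_cartesian (T : monad) :=
  forall (X Y : Type) (f : X -> Y),
    weak_pullback (mmap T f) (@mmult T Y) (@mmult T X) (mmap T (mmap T f)).

(** * Quantales and V-relations *)

Record quantale (d : Order.disp_t) (V : tbLatticeType d) := Quantale {
  qsup : set V -> V;
  qsupP : forall A : set V, isLub A (qsup A);
  qtens : V -> V -> V;
  qunit : V;
  qhom : V -> V -> V;
  qtensA : associative qtens;
  qtensC : commutative qtens;
  qtens1 : left_id qunit qtens;
  qhomP : forall u v w : V, (qtens u v <= w)%O = (v <= qhom u w)%O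
}.

Definition heyting_algebra (d : Order.disp_t) (V : tbLatticeType d) :=
  forall u : V, exists imp : V -> V,
    forall v w : V, (u `&` v <= w)%O = (v <= imp w)%O.

Section VRel.
Variables (d : Order.disp_t) (V : tbLatticeType d) (K : quantale V).

Definition vrel (X Y : Type) := X -> Y -> V.

Definition vcomp (X Y Z : Type) (s : vrel Y Z) (r : vrel X Y) : vrel X Z :=
  fun x z => qsup K (range (fun y => qtens K (r x y) (s y z))).

Definition vgraph (X Y : Type) (f : X -> Y) : vrel X Y :=
  fun x y => if `[< f x = y >] then qunit K else (\bot)%O.

Definition vmeet (X X' Y Y' : Type) (r : vrel X X') (s : vrel Y Y') :
    vrel (X * Y) (X' * Y') :=
  fun p q => (r p.1 q.1 `&` s p.2 q.2)%O.

Definition vscale (X Y : Type) (r : vrel X Y) (u : V) : vrel X Y :=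
  fun x y => qtens K (r x y) u.

(* The action of the covariant V-powerset functor on maps. *)
Definition vdirect_image (X Y : Type) (f : X -> Y) (phi : X -> V) : Y -> V :=
  fun y => qsup K [set phi x | x in [set x | f x = y]].

Variable T : monad.

Record strict_topological_theory (xi : T V -> V) : Prop := StrictTheory {
  theory_EM : EM_algebra xi;
  theory_tens : forall w : T (V * V)%type,
    xi (mmap T (fun p => qtens K p.1 p.2) w)
    = qtens K (xi (mmap T fst w)) (xi (mmap T snd w));
  theory_unit : forall t : T unit, xi (mmap T (fun=> qunit K) t) = qunit K;
  theory_mono : forall (X : Type) (phi psi : X -> V),
    (forall x, (phi x <= psi x)%O) ->
    forall t : T X, (xi (mmap T phi t) <= xi (mmap T psi t))%O;
  theory_nat : forall (X Y : Type) (f : X -> Y) (phi : X -> V) (t : T Y),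
    xi (mmap T (vdirect_image f phi) t)
    = vdirect_image (mmap T f) (fun t' => xi (mmap T phi t')) t
}.

Definition can (X Y : Type) (w : T (X * Y)%type) : T X * T Y :=
  (mmap T fst w, mmap T snd w).

Variable xi : T V -> V.

Definition vext (X Y : Type) (r : vrel X Y) : vrel (T X) (T Y) :=
  fun x y => qsup K [set xi (mmap T (fun p => r p.1 p.2) w)
                    | w in [set w | mmap T fst w = x /\ mmap T snd w = y]].

Definition TV_category (X : Type) (a : vrel (T X) X) :=
  (forall x : X, (qunit K <= a (munit T x) x)%O) /\
  (forall (tt : T (T X)) (t : T X) (x : X),
     (qtens K (vext a tt t) (a t x) <= a (mmult T tt) x)%O).

Definition TV_functor (X Y : Type) (a : vrel (T X) X) (b : vrel (T Y) Y)
    (f : X -> Y) :=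
  forall (t : T X) (x : X), (a t x <= b (mmap T f t) (f x))%O.

Definition TV_tensor (X Y : Type) (a : vrel (T X) X) (b : vrel (T Y) Y) :
    vrel (T (X * Y)%type) (X * Y) :=
  fun w p => qtens K (a (mmap T fst w) p.1) (b (mmap T snd w) p.2).

Definition hom_xi : vrel (T V) V := fun t v => qhom K (xi t) v.

Record TVobj := TVObj {
  TVcarrier :> Type;
  TVstr : vrel (T TVcarrier) TVcarrier;
  TVstrP : TV_category TVstr
}.

Record TVhom (X Y : TVobj) := TVHom {
  TVfun :> X -> Y;
  TVfunP : TV_functor (@TVstr X) (@TVstr Y) TVfun
}.

Lemma TVhom_eq (X Y : TVobj) (f g : TVhom X Y) : TVfun f = TVfun g -> f = g.
Proof.
case: f g => [f fP] [g gP] /= fg; case: _ / fg gP => gP.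
by congr TVHom; exact: Prop_irrelevance.
Qed.

Lemma TVid_subproof (X : TVobj) :
  TV_functor (@TVstr X) (@TVstr X) (fun x => x).
Proof. by move=> t x; rewrite mmap1. Qed.

Definition TVid (X : TVobj) : TVhom X X := TVHom (@TVid_subproof X).

Lemma TVcomp_subproof (X Y Z : TVobj) (g : TVhom Y Z) (f : TVhom X Y) :
  TV_functor (@TVstr X) (@TVstr Z) (fun x => g (f x)).
Proof.
move=> t x; rewrite (mmapM g f).
by apply: le_trans (TVfunP f t x) _; exact: (TVfunP g).
Qed.

Definition TVcomp (X Y Z : TVobj) (g : TVhom Y Z) (f : TVhom X Y) : TVhom X Z :=
  TVHom (TVcomp_subproof g f).

Lemma TVcompA (W X Y Z : TVobj) (h : TVhom Y Z) (g : TVhom X Y) (f : TVhom W X) :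
  TVcomp h (TVcomp g f) = TVcomp (TVcomp h g) f.
Proof. exact: TVhom_eq. Qed.

Lemma TVcomp1l (X Y : TVobj) (f : TVhom X Y) : TVcomp (TVid Y) f = f.
Proof. exact: TVhom_eq. Qed.

Lemma TVcomp1r (X Y : TVobj) (f : TVhom X Y) : TVcomp f (TVid X) = f.
Proof. exact: TVhom_eq. Qed.

Definition TVCat : category := Category TVcompA TVcomp1l TVcomp1r.

End VRel.

(* Main.v *)
Require Import Defs.
From HB Require Import structures.
From mathcomp Require Import all_boot all_order.
From mathcomp Require Import boolp classical_sets.
Import Order.TTheory.
Local Open Scope classical_set_scope.

Set Implicit Arguments.
Unset Strict Implicit.
Unset Printing Implicit Defensive.

Local Notation idm := Defs.cid.

(** The completion of C is realised as the category of pseudo-equivalence relations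
of C, read stagewise: a pair of parallel morphisms R -> X induces at every stage a
relation on the generalised elements of X, required to be an equivalence, and a
morphism is a morphism of carriers that respects these relations, taken up to the
relation of the target. Every object is then a quotient of a discrete one, the
regular epimorphisms are the morphisms along which generalised elements lift, and
an equivalence relation on (X, R) is effective because the relation it induces on
the elements of X is again that of a pseudo-equivalence relation on X (Cex_exact).
A lex functor F into an exact category extends by sending (X, R) to the quotient of
F X by the image of F R, which is an equivalence relation because F preserves finite
limits. The extension is regular because in an exact category the elements of a
quotient lift locally, that is, after composition with a regular epimorphism
(extend_regular). A natural transformation extends uniquely by descent along the
covers by discrete objects (natural_extension).

Any two exact completions are equivalent, so cartesian closure needs to be proved
for this one only. The exponential of (Y, S) by (X, R) is carried by the part of a
weak exponential of Y by X in C whose elements respect the relations, and two such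
elements are related when their values are. Both conditions quantify over X or R, so
one needs that the predicates represented by a morphism of C are closed under
universal quantification along product projections (covered_forall). This follows
from weak exponentials as soon as C has, for all u and v from P x X to Z, a universal
part of P over which u and v agree; in the category of (T,V)-categories that part is
a subset of P with the initial structure.

There remain the weak exponentials of (T,V)-categories. Every X has a fully faithful
Yoneda functor into an object of V-valued presheaves on X. Presheaf objects are
injective with respect to fully faithful functors, by left Kan extension, and they
are exponentiable. Indeed, compatibility of the extension with meets and the Heyting
structure of V reduce exponentiability to an inequality that decomposes convergence
(decomposable, expo_category); for presheaves it is witnessed by colimits tensored
with elements of V (presheaf_decomposable), which is where the formula for meets with
tensors and the compatibility of the extension with scaling enter. A weak exponential
of Y by X then consists of the functors from presheaves on X to presheaves on Y that
restrict to a map from X to Y (TVCat_weak_exponentials). *)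

(** * Regular epimorphisms and local existence *)

Section Covers.
Variable C : category.
Implicit Types W X Y Z : C.

Lemma regular_epi_epi X Y (e : chom X Y) : regular_epi e ->
  forall Z (u v : chom Y Z), u \co e = v \co e -> u = v.
Proof.
move=> [R [f [g [fg cq]]]] Z u v uv.
have [|h [_ hP]] := cq _ (v \co e); first by rewrite -!ccompA fg.
by rewrite -(hP u uv) -(hP v erefl).
Qed.

Lemma regular_epi_descend X Y (e : chom X Y) : regular_epi e ->
  forall Z (w : chom X Z),
    (forall W (a b : chom W X), e \co a = e \co b -> w \co a = w \co b) ->
  exists h : chom Y Z, h \co e = w.
Proof.
move=> [R [f [g [fg cq]]]] Z w wP.
by have [h [hw _]] := cq _ w (wP _ _ _ fg); exists h.
Qed.

(** The given presentation of e as a coequalizer is by a pair that e equalizes, and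
such a pair factors through the kernel pair. *)
Lemma coequalizer_kernel_pair X Y P (e : chom X Y) (p q : chom P X) :
  regular_epi e -> is_pullback e e p q -> is_coequalizer p q e.
Proof.
move=> re [epq pb]; split=> // W u upq.
have [|h hu] := regular_epi_descend re (w := u).
  move=> V a b /pb[k [[<- <-] _]].
  by rewrite !ccompA upq.
exists h; split=> // h' h'u; apply: (regular_epi_epi re).
by rewrite hu h'u.
Qed.

Lemma regular_epi_of_descend X Y P (f : chom X Y) (p q : chom P X) :
  is_pullback f f p q ->
  (forall Z (u v : chom Y Z), u \co f = v \co f -> u = v) ->
  (forall Z (w : chom X Z),
    (forall W (a b : chom W X), f \co a = f \co b -> w \co a = w \co b) ->
    exists h : chom Y Z, h \co f = w) ->
  regular_epi f.
Proof.
move=> [fpq pb] epi desc; exists P, p, q; split=> // W w wpq.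
have [|h hw] := desc _ w.
  move=> V a b /pb[k [[<- <-] _]].
  by rewrite !ccompA wpq.
exists h; split=> // h' h'w; apply: epi.
by rewrite hw h'w.
Qed.

Lemma regular_epi_id X : regular_epi (idm X).
Proof.
exists X, (idm X), (idm X); split=> // W u _.
by exists u; split=> [|v <-]; rewrite ccomp1r.
Qed.

Definition jointly_monic R X Y (r1 : chom R X) (r2 : chom R Y) :=
  forall W (u v : chom W R),
    r1 \co u = r1 \co v -> r2 \co u = r2 \co v -> u = v.

(** A factorisation through a jointly monic pair need only exist locally: local
factorisations are unique, hence descend. *)
Lemma jointly_monic_local R X Y (r1 : chom R X) (r2 : chom R Y)
    W W' (e : chom W' W) (h : chom W' R) (x : chom W X) (y : chom W Y) :
  jointly_monic r1 r2 -> regular_epi e ->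
  r1 \co h = x \co e -> r2 \co h = y \co e ->
  exists k : chom W R, r1 \co k = x /\ r2 \co k = y.
Proof.
move=> rm re h1 h2.
have [|k ke] := regular_epi_descend re (w := h).
  move=> V a b eab; apply: rm.
    by rewrite !ccompA h1 -!ccompA eab.
  by rewrite !ccompA h2 -!ccompA eab.
exists k; split; apply: (regular_epi_epi re).
  by rewrite -ccompA ke.
by rewrite -ccompA ke.
Qed.

Lemma pullback_jointly_monic X Y Z P (f : chom X Z) (g : chom Y Z)
    (p : chom P X) (q : chom P Y) :
  is_pullback f g p q -> jointly_monic p q.
Proof.
move=> [fg pb] W u v pu qu.
have [|h [_ hP]] := pb _ (p \co v) (q \co v); first by rewrite !ccompA fg.
by rewrite -(hP u) // -(hP v).
Qed.

Lemma kernel_pair_equivalence X Y P (f : chom X Y) (p q : chom P X) :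
  is_pullback f f p q -> equivalence_relation p q.
Proof.
move=> pb; have pm := pullback_jointly_monic pb; case: pb => fpq pb.
split=> //.
- by have [d [dP _]] := pb _ (idm X) (idm X) erefl; exists d.
- by have [s [sP _]] := pb _ q p (esym fpq); exists s.
- move=> Q a b [ab _].
  have [|t [tP _]] := pb _ (p \co a) (q \co b); last by exists t.
  by rewrite !ccompA fpq -!ccompA ab !ccompA fpq.
Qed.

End Covers.

Section RegularCategory.
Variables (A : category) (Areg : regular_category A).
Implicit Types W X Y Z : A.

Lemma regular_pullback X Y Z (f : chom X Z) (g : chom Y Z) :
  exists P (p : chom P X) (q : chom P Y), is_pullback f g p q.
Proof. by case: Areg => -[_ +] _ _; apply. Qed.

(** Regular epimorphisms are locally surjective on generalised elements: the pullback
of e along y is the required cover of the stage. *)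
Lemma regular_epi_lift X Y (e : chom X Y) W (y : chom W Y) : regular_epi e ->
  exists W' (e' : chom W' W) (x : chom W' X), regular_epi e' /\ e \co x = y \co e'.
Proof.
move=> re; have [P [p [q pb]]] := regular_pullback e y.
exists P, q, p; split; last by case: pb.
by case: Areg => _ _ st; apply: st pb re.
Qed.

(** To descend along g what already descends along f, two elements of Y with the same
image under g are first lifted along f, locally. *)
Lemma regular_epi_comp X Y Z (g : chom Y Z) (f : chom X Y) :
  regular_epi g -> regular_epi f -> regular_epi (g \co f).
Proof.
move=> rg rf; have [P [p [q pb]]] := regular_pullback (g \co f) (g \co f).
apply: (regular_epi_of_descend pb) => [W u v | W w wP].
  rewrite !ccompA => /(regular_epi_epi rf).
  exact: (regular_epi_epi rg).
have [|w' w'f] := regular_epi_descend rf (w := w).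
  by move=> V a b ab; apply: wP; rewrite -!ccompA ab.
have [|h hg] := regular_epi_descend rg (w := w'); last first.
  by exists h; rewrite ccompA hg.
move=> V a b gab.
have [V1 [e1 [x [re1 ax]]]] := regular_epi_lift a rf.
have [V2 [e2 [y [re2 yb]]]] := regular_epi_lift (b \co e1) rf.
apply: (regular_epi_epi re1); apply: (regular_epi_epi re2).
rewrite -(ccompA w') -(ccompA w') -ax -(ccompA w') -(ccompA w') -yb.
rewrite !ccompA w'f -!ccompA; apply: wP.
by rewrite -!ccompA (ccompA f) ax yb !ccompA gab.
Qed.

(** A morphism that respects the kernel of f also respects, after composition with x,
that of f \co x, so it descends along f \co x; that the descended morphism composes
with f to the original one is checked on the pullback of f \co x along f. *)
Lemma regular_epi_of_comp X Y W (f : chom X Y) (x : chom W X) :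
  regular_epi (f \co x) -> regular_epi f.
Proof.
move=> re; have [P [p [q pb]]] := regular_pullback f f.
apply: (regular_epi_of_descend pb) => [Z u v uv | Z w wP].
  by apply: (regular_epi_epi re); rewrite !ccompA uv.
have [|h hx] := regular_epi_descend re (w := w \co x).
  move=> V a b ab; rewrite -!ccompA; apply: wP.
  by rewrite !ccompA.
exists h.
have [U [e [k [reU ke]]]] := regular_epi_lift f re.
apply: (regular_epi_epi reU).
rewrite -ccompA -ke ccompA hx -ccompA.
by apply: wP; rewrite ccompA.
Qed.

End RegularCategory.

(** * Binary products and covered predicates *)

Record binary_products (C : category) := BinaryProducts {
  bprod : C -> C -> C;
  bfst : forall X Y, chom (bprod X Y) X;
  bsnd : forall X Y, chom (bprod X Y) Y;
  bpair : forall W X Y, chom W X -> chom W Y -> chom W (bprod X Y);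
  bfst_pair : forall W X Y (u : chom W X) (v : chom W Y),
    bfst X Y \co bpair u v = u;
  bsnd_pair : forall W X Y (u : chom W X) (v : chom W Y),
    bsnd X Y \co bpair u v = v;
  bprod_monic : forall X Y, jointly_monic (bfst X Y) (bsnd X Y)
}.
Arguments bprod {C} b X Y.
Arguments bfst {C b X Y}.
Arguments bsnd {C b X Y}.
Arguments bpair {C} b {W X Y} u v.

Section BinaryProducts.
Variables (C : category).

Lemma is_product_of_pullback (X Y T P : C) (f : chom X T) (g : chom Y T)
    (p : chom P X) (q : chom P Y) :
  is_terminal T -> is_pullback f g p q -> is_product p q.
Proof.
move=> Tt [_ pb] W u v; apply: pb.
by have [t [_ tP]] := Tt W; rewrite -(tP (f \co u)) // -(tP (g \co v)).
Qed.

Lemma finitely_complete_product : finitely_complete C ->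
  forall X Y : C, exists P (p : chom P X) (q : chom P Y), is_product p q.
Proof.
move=> [[T Tt] pb] X Y.
have [f _] := Tt X; have [g _] := Tt Y.
have [P [p [q pbP]]] := pb _ _ _ f g.
by exists P, p, q; apply: is_product_of_pullback Tt pbP.
Qed.

Lemma choose_products :
  (forall X Y : C, exists P (p : chom P X) (q : chom P Y), is_product p q) ->
  inhabited (binary_products C).
Proof.
move=> prodC.
pose P X Y := projT1 (boolp.cid (prodC X Y)).
pose pP X Y := projT2 (boolp.cid (prodC X Y)).
pose p X Y := projT1 (boolp.cid (pP X Y)).
pose qP X Y := projT2 (boolp.cid (pP X Y)).
pose q X Y := projT1 (boolp.cid (qP X Y)).
have prodP X Y : is_product (p X Y) (q X Y) := projT2 (boolp.cid (qP X Y)).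
pose h W X Y u v := projT1 (boolp.cid (prodP X Y W u v)).
have hP W X Y u v : p X Y \co h W X Y u v = u /\ q X Y \co h W X Y u v = v.
  by have [] := projT2 (boolp.cid (prodP X Y W u v)).
constructor; exists P p q h.
- by move=> W X Y u v; case: (hP W X Y u v).
- by move=> W X Y u v; case: (hP W X Y u v).
- move=> X Y W u v pu qu.
  have [k [_ kP]] := prodP X Y W (p X Y \co v) (q X Y \co v).
  by rewrite -(kP u) // -(kP v).
Qed.

Variable bp : binary_products C.

Lemma bpair_comp W W' (X Y : C) (u : chom W X) (v : chom W Y) (w : chom W' W) :
  bpair bp u v \co w = bpair bp (u \co w) (v \co w).
Proof.
by apply: (@bprod_monic _ bp); rewrite ccompA ?bfst_pair ?bsnd_pair.
Qed.

Lemma bpair_eta W (X Y : C) (u : chom W (bprod bp X Y)) :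
  bpair bp (bfst \co u) (bsnd \co u) = u.
Proof. by apply: (@bprod_monic _ bp); rewrite ?bfst_pair ?bsnd_pair. Qed.

Lemma is_product_bprod X Y : is_product (@bfst _ bp X Y) bsnd.
Proof.
move=> W u v; exists (bpair bp u v); split; first by rewrite bfst_pair bsnd_pair.
by move=> h [<- <-]; rewrite bpair_eta.
Qed.

End BinaryProducts.

(** A weak form of representability by a subobject of P: r need not be monic, so the
factorisations need not be unique, and r is determined only up to mutual
factorisation. *)
Definition covered (C : category) (P : C) (A : forall W, chom W P -> Prop) :=
  exists R (r : chom R P), forall W (x : chom W P),
    A W x <-> exists rho : chom W R, r \co rho = x.

Section Covered.
Variables (C : category) (Clex : finitely_complete C) (bp : binary_products C).
Implicit Types P Q R X Y W Z : C.

Lemma covered_stable P A : @covered C P A ->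
  forall W W' (x : chom W P) (w : chom W' W), A W x -> A W' (x \co w).
Proof.
move=> [R [r rP]] W W' x w /rP[rho <-]; apply/rP.
by exists (rho \co w); rewrite ccompA.
Qed.

Lemma eq_covered P A B : (forall W x, A W x <-> B W x) ->
  @covered C P A -> @covered C P B.
Proof.
move=> AB [R [r rP]]; exists R, r => W x.
by rewrite -AB.
Qed.

Lemma covered_preimage P Q (f : chom P Q) A :
  @covered C Q A -> @covered C P (fun W x => A W (f \co x)).
Proof.
move=> [R [r rP]]; case: Clex => _ /(_ _ _ _ f r)[S [p [q [pq pb]]]].
exists S, p => W x; rewrite rP; split.
  move=> [rho rx].
  by have [k [[kx _] _]] := pb _ x rho (esym rx); exists k.
by move=> [k <-]; exists (q \co k); rewrite !ccompA pq.
Qed.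

Lemma covered_and P A B : @covered C P A -> @covered C P B ->
  @covered C P (fun W x => A W x /\ B W x).
Proof.
move=> [R [r rP]] /(covered_preimage r)[S [s sP]].
exists S, (r \co s) => W x; rewrite rP; split.
  move=> [[rho <-] /sP[k <-]]; exists k.
  by rewrite ccompA.
move=> [k <-]; split; first by exists (s \co k); rewrite ccompA.
by rewrite -ccompA; apply/sP; exists k.
Qed.

(** Existential quantification asks for the witness at the same stage, which is why
it is covered by mere composition. *)
Lemma covered_image P Q (f : chom P Q) A : @covered C P A ->
  @covered C Q (fun W y => exists x : chom W P, f \co x = y /\ A W x).
Proof.
move=> [R [r rP]]; exists R, (f \co r) => W y; split.
  by move=> [x [<- /rP[k <-]]]; exists k; rewrite ccompA.
move=> [k <-]; exists (r \co k); rewrite ccompA; split=> //.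
by apply/rP; exists k.
Qed.

Lemma covered_ex P Z A : @covered C (bprod bp P Z) A ->
  covered (fun W (x : chom W P) => exists z : chom W Z, A W (bpair bp x z)).
Proof.
move=> /(covered_image bfst); apply: eq_covered => W x; split.
  by move=> [y [<- Ay]]; exists (bsnd \co y); rewrite bpair_eta.
by move=> [z Az]; exists (bpair bp x z); rewrite bfst_pair.
Qed.

End Covered.

(** * Pseudo-equivalence relations *)

Section ExactCompletionCategory.
Variables (C : category).

Definition span_rel (R X : C) (r1 r2 : chom R X) W (x y : chom W X) :=
  exists rho : chom W R, r1 \co rho = x /\ r2 \co rho = y.

Definition stagewise_equivalence (X : C)
    (E : forall W, chom W X -> chom W X -> Prop) :=
  [/\ forall W (x : chom W X), E W x x,
      forall W (x y : chom W X), E W x y -> E W y x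
    & forall W (x y z : chom W X), E W x y -> E W y z -> E W x z].

(** Pseudo-equivalence relations: reflexivity, symmetry and transitivity at the
universal stages X, R and the pullback of R with itself are the structural morphisms
of the usual definition. *)
Record exobj := ExObj {
  excar : C;
  exrel : C;
  ex1 : chom exrel excar;
  ex2 : chom exrel excar;
  ex_equivalence : stagewise_equivalence (fun W => @span_rel _ _ ex1 ex2 W)
}.

Definition erel (X : exobj) W (x y : chom W (excar X)) :=
  span_rel (@ex1 X) (@ex2 X) x y.

Section Erel.
Variable X : exobj.

Lemma erel_refl W (x : chom W (excar X)) : erel x x.
Proof. by case: (ex_equivalence X) => er _ _; apply: er. Qed.

Lemma erel_eq W (x y : chom W (excar X)) : x = y -> erel x y.
Proof. by move=> ->; apply: erel_refl. Qed.

Lemma erel_sym W (x y : chom W (excar X)) : erel x y -> erel y x.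
Proof. by case: (ex_equivalence X) => _ es _; apply: es. Qed.

Lemma erel_trans W (y x z : chom W (excar X)) : erel x y -> erel y z -> erel x z.
Proof. by case: (ex_equivalence X) => _ _ et; apply: et. Qed.

Lemma erel_comp W W' (x y : chom W (excar X)) (w : chom W' W) :
  erel x y -> erel (x \co w) (y \co w).
Proof. by move=> [rho [<- <-]]; exists (rho \co w); rewrite !ccompA. Qed.

Lemma erel_gen : erel (ex1 X) (ex2 X).
Proof. by exists (idm _); rewrite !ccomp1r. Qed.

End Erel.

Definition compatible (X Y : exobj) (f : chom (excar X) (excar Y)) :=
  forall W (x y : chom W (excar X)), erel x y -> erel (f \co x) (f \co y).

Lemma compatible_id X : compatible (X := X) (Y := X) (idm _).
Proof. by move=> W x y; rewrite !ccomp1l. Qed.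

Lemma compatible_comp (X Y Z : exobj) (g : chom (excar Y) (excar Z))
    (f : chom (excar X) (excar Y)) :
  compatible g -> compatible f -> compatible (X := X) (Y := Z) (g \co f).
Proof. by move=> cg cf W x y xy; rewrite -!ccompA; apply/cg/cf. Qed.

(** A morphism is an equivalence class of compatible morphisms of carriers, encoded as
a predicate in order that Hom-types carry Leibniz equality. *)
Record exhom (X Y : exobj) := ExHom {
  exclass : chom (excar X) (excar Y) -> Prop;
  exclassP : exists f, compatible f /\ exclass = (fun g => erel f g)
}.

Definition cls (X Y : exobj) (f : chom (excar X) (excar Y)) (cf : compatible f) :
  exhom X Y := ExHom (ex_intro _ f (conj cf erefl)).

Definition rep (X Y : exobj) (h : exhom X Y) : chom (excar X) (excar Y) :=
  projT1 (boolp.cid (exclassP h)).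

Lemma rep_compatible X Y (h : exhom X Y) : compatible (rep h).
Proof. by rewrite /rep; case: boolp.cid => f []. Qed.

Lemma exhom_ext X Y (h h' : exhom X Y) : exclass h = exclass h' -> h = h'.
Proof.
case: h h' => [A Ap] [B Bp] /= AB; case: _ / AB in Bp *.
by congr ExHom; apply: Prop_irrelevance.
Qed.

Lemma exhom_eqP X Y (h h' : exhom X Y) : h = h' <-> erel (rep h) (rep h').
Proof.
split=> [-> | ]; first exact: erel_refl.
rewrite /rep; case: boolp.cid => f [cf hf]; case: boolp.cid => f' [cf' hf'] /= ff'.
apply: exhom_ext; rewrite hf hf'; apply: funext => g; apply: propext.
by split; apply: erel_trans => //; apply: erel_sym.
Qed.

Lemma rep_cls X Y f (cf : compatible f) : erel (rep (@cls X Y f cf)) f.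
Proof.
rewrite /rep; case: boolp.cid => g [cg] /= e.
by move/(congr1 (fun A => A f)): e => <-; apply: erel_refl.
Qed.

Lemma cls_rep X Y (h : exhom X Y) : cls (@rep_compatible _ _ h) = h.
Proof. by apply/exhom_eqP; apply: rep_cls. Qed.

Lemma cls_eqP X Y f g (cf : compatible f) (cg : compatible g) :
  @cls X Y f cf = @cls X Y g cg <-> erel f g.
Proof.
rewrite exhom_eqP; split=> fg.
  apply: erel_trans (rep_cls cg); apply: erel_trans fg.
  exact/erel_sym/rep_cls.
apply: erel_trans (erel_sym (rep_cls cg)); apply: erel_trans fg.
exact/rep_cls.
Qed.

Definition exid X : exhom X X := cls (@compatible_id X).

Definition excomp X Y Z (g : exhom Y Z) (f : exhom X Y) : exhom X Z :=
  cls (compatible_comp (@rep_compatible _ _ g) (@rep_compatible _ _ f)).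

Lemma erel_rep_comp X Y Z (g : exhom Y Z) (f : exhom X Y) :
  erel (rep (excomp g f)) (rep g \co rep f).
Proof. exact: rep_cls. Qed.

Lemma excompA W X Y Z (h : exhom Y Z) (g : exhom X Y) (f : exhom W X) :
  excomp h (excomp g f) = excomp (excomp h g) f.
Proof.
apply/cls_eqP; apply: erel_trans (_ : erel (rep h \co (rep g \co rep f)) _).
  by apply: rep_compatible; apply: rep_cls.
by rewrite ccompA; apply: erel_comp; apply/erel_sym/rep_cls.
Qed.

Lemma excomp1l X Y (f : exhom X Y) : excomp (exid Y) f = f.
Proof.
apply/exhom_eqP; apply: erel_trans (erel_rep_comp _ _) _.
by rewrite -{2}(ccomp1l (rep f)); apply/erel_comp/rep_cls.
Qed.

Lemma excomp1r X Y (f : exhom X Y) : excomp f (exid X) = f.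
Proof.
apply/exhom_eqP; apply: erel_trans (erel_rep_comp _ _) _.
by rewrite -{2}(ccomp1r (rep f)); apply/rep_compatible/rep_cls.
Qed.

Definition Cex : category := Category excompA excomp1l excomp1r.

Lemma diag_equivalence (X : C) :
  stagewise_equivalence (fun W => @span_rel X X (idm X) (idm X) W).
Proof.
have E W (x y : chom W X) : span_rel (idm X) (idm X) x y <-> x = y.
  split=> [[r] | ->]; last by exists y; rewrite ccomp1l.
  by rewrite ccomp1l => -[-> ->].
split=> W x; first by apply/E.
  by move=> y /E ->; apply/E.
by move=> y z /E -> /E ->; apply/E.
Qed.

Definition exdisc (X : C) : exobj := ExObj (diag_equivalence X).

Lemma erel_disc X W (x y : chom W (excar (exdisc X))) : erel x y <-> x = y.
Proof.
split=> [[r] /= | ->]; last by exists y; rewrite ccomp1l.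
by rewrite !ccomp1l => -[-> ->].
Qed.

Lemma compatible_disc X Y (f : chom X (excar Y)) :
  compatible (X := exdisc X) (Y := Y) f.
Proof. by move=> W x y /erel_disc ->; apply: erel_refl. Qed.

(** Since elements at stage W are related by the discrete object on W only when equal,
any generalised element of excar Y is compatible; it is the same, up to the relation
of Y, as a morphism from that discrete object. *)
Definition elt W (Y : exobj) (y : chom W (excar Y)) : chom (exdisc W : Cex) Y :=
  cls (compatible_disc y).

Lemma elt_eqP W Y (y y' : chom W (excar Y)) : elt y = elt y' <-> erel y y'.
Proof. exact: cls_eqP. Qed.

Lemma eltK W Y (y : chom (exdisc W : Cex) Y) : elt (rep y) = y.
Proof. by apply/exhom_eqP; apply: rep_cls. Qed.

Lemma comp_elt W (X Y : exobj) (f : chom (X : Cex) Y) (x : chom W (excar X)) :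
  f \co elt x = elt (rep f \co x).
Proof.
apply/cls_eqP; apply: rep_compatible.
exact: rep_cls.
Qed.

Lemma cls_elt W (X Y : exobj) f (cf : compatible f) (x : chom W (excar X)) :
  (@cls X Y f cf : chom (X : Cex) Y) \co elt x = elt (f \co x).
Proof.
rewrite comp_elt; apply/elt_eqP; apply: erel_comp.
exact: rep_cls.
Qed.

Lemma elt_disc W W' Y (y : chom W (excar Y)) (w : chom W' W) :
  elt y \co elt (Y := exdisc W) w = elt (y \co w).
Proof. exact: cls_elt. Qed.

Definition excover (Y : exobj) : chom (exdisc (excar Y) : Cex) Y := elt (idm _).

Lemma excover_elt W Y (y : chom W (excar Y)) :
  excover Y \co elt (Y := exdisc _) y = elt y.
Proof. by rewrite /excover elt_disc ccomp1l. Qed.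

Definition disc_obj (X : C) : Cex := exdisc X.
Definition disc_map (X Y : C) (f : chom X Y) : chom (disc_obj X) (disc_obj Y) :=
  elt (Y := exdisc Y) f.

Lemma disc_map1 X : disc_map (idm X) = idm (disc_obj X).
Proof. exact/cls_eqP/erel_refl. Qed.

Lemma disc_mapM X Y Z (g : chom Y Z) (f : chom X Y) :
  disc_map (g \co f) = disc_map g \co disc_map f.
Proof. by rewrite /disc_map elt_disc. Qed.

Definition disc : functor C Cex := Functor disc_map1 disc_mapM.

(** The generic element, the identity of the carrier, already separates morphisms. *)
Lemma exhom_elt_ext (X Y : exobj) (f g : chom (X : Cex) Y) :
  (forall W (x : chom W (excar X)), f \co elt x = g \co elt x) -> f = g.
Proof.
move=> fg; apply/exhom_eqP; have := fg _ (idm _).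
by rewrite !comp_elt !ccomp1r => /elt_eqP.
Qed.

Lemma exhom_of_elt (X Y : exobj) (f : chom (exdisc (excar X) : Cex) Y) :
  (forall W (x y : chom W (excar X)), erel x y ->
     f \co elt (Y := exdisc _) x = f \co elt (Y := exdisc _) y) ->
  exists g : chom (X : Cex) Y, g \co excover X = f.
Proof.
move=> fP.
have cf : compatible (X := X) (Y := Y) (rep f).
  by move=> W x y /fP; rewrite !comp_elt => /elt_eqP.
by exists (cls cf); rewrite cls_elt ccomp1r eltK.
Qed.

End ExactCompletionCategory.
Arguments disc {C}.

(** * Exactness of the completion *)

Section Exactness.
Variables (C : category) (Clex : finitely_complete C) (bp : binary_products C).
Local Notation CX := (Cex C).

(* The objects of the completion used below arise from an equivalence relation on
   generalised elements that is covered; the morphisms ex1 and ex2 are then the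
   components of the covering morphism. *)
Section BuildObject.
Variables (X : C) (E : forall W, chom W X -> chom W X -> Prop).
Hypothesis Ecov :
  covered (fun W (p : chom W (bprod bp X X)) => E (bfst \co p) (bsnd \co p)).
Hypothesis Eeqv : stagewise_equivalence E.

Definition build_map := projT1 (boolp.cid (projT2 (boolp.cid Ecov))).

Lemma build_relP W (x y : chom W X) :
  span_rel (bfst \co build_map) (bsnd \co build_map) x y <-> E x y.
Proof.
have /(_ W (bpair bp x y)) := projT2 (boolp.cid (projT2 (boolp.cid Ecov))).
rewrite -/build_map bfst_pair bsnd_pair => ->; split.
  by move=> [r [<- <-]]; exists r; rewrite -!ccompA bpair_eta.
by move=> [r rE]; exists r; rewrite -!ccompA rE bfst_pair bsnd_pair.
Qed.

Lemma build_equivalence : stagewise_equivalence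
  (fun W => span_rel (bfst \co build_map) (bsnd \co build_map) (W := W)).
Proof.
case: Eeqv => er es et; split=> W.
- by move=> x; apply/build_relP.
- by move=> x y /build_relP xy; apply/build_relP/es.
- by move=> x y z /build_relP xy /build_relP yz; apply/build_relP/(et _ _ y).
Qed.

Definition build_exobj : exobj C := ExObj build_equivalence.

Lemma build_erelP W (x y : chom W (excar build_exobj)) : erel x y <-> E x y.
Proof. exact: build_relP. Qed.

End BuildObject.

Lemma covered_erel (Y : exobj C) (P : C) (f g : chom P (excar Y)) :
  covered (fun W (x : chom W P) => erel (f \co x) (g \co x)).
Proof.
have cY : covered (fun W (p : chom W (bprod bp (excar Y) (excar Y))) =>
    erel (bfst \co p) (bsnd \co p)).
  exists (exrel Y), (bpair bp (ex1 Y) (ex2 Y)) => W p; split=> -[r].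
    by case=> r1 r2; exists r; rewrite bpair_comp r1 r2 bpair_eta.
  by move=> <-; exists r; rewrite bpair_comp bfst_pair bsnd_pair.
apply: eq_covered (covered_preimage Clex (bpair bp f g) cY) => W x.
by rewrite bpair_comp bfst_pair bsnd_pair.
Qed.

Lemma covered_erel_build (X : C) (Y : exobj C) (f : chom X (excar Y)) :
  covered (fun W (p : chom W (bprod bp X X)) =>
    erel (f \co (bfst \co p)) (f \co (bsnd \co p))).
Proof.
have := covered_erel (f \co bfst (b := bp)) (f \co bsnd).
by apply: eq_covered => W p; rewrite !ccompA.
Qed.

Lemma pullback_equivalence (X : C) (Y : exobj C) (f : chom X (excar Y)) :
  stagewise_equivalence (fun W (x y : chom W X) => erel (f \co x) (f \co y)).
Proof.
split=> W; first by move=> x; apply: erel_refl.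
  by move=> x y; apply: erel_sym.
by move=> x y z; apply: erel_trans.
Qed.

Lemma covered_erel2 (X : C) (Y Z : exobj C) (f : chom X (excar Y))
    (g : chom X (excar Z)) :
  covered (fun W (p : chom W (bprod bp X X)) =>
    erel (f \co (bfst \co p)) (f \co (bsnd \co p)) /\
    erel (g \co (bfst \co p)) (g \co (bsnd \co p))).
Proof. by apply: (covered_and Clex); apply: covered_erel_build. Qed.

Lemma pullback_equivalence2 (X : C) (Y Z : exobj C) (f : chom X (excar Y))
    (g : chom X (excar Z)) :
  stagewise_equivalence (fun W (x y : chom W X) =>
    erel (f \co x) (f \co y) /\ erel (g \co x) (g \co y)).
Proof.
have [fr fs ft] := pullback_equivalence f.
have [gr gs gt] := pullback_equivalence g.
split=> W; first by split; [apply: fr | apply: gr].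
  by move=> x y []; split; [apply: fs | apply: gs].
by move=> x y z [xy xy'] [yz yz']; split; [apply: ft yz | apply: gt yz'].
Qed.

(** X with the coarsest relation that makes f and g compatible; for that relation
they become jointly monic. *)
Definition ex_initial2 X Y Z (f : chom X (excar Y)) (g : chom X (excar Z)) :=
  build_exobj (covered_erel2 f g) (pullback_equivalence2 f g).

Lemma ex_initial2P X Y Z (f : chom X (excar Y)) (g : chom X (excar Z)) W
    (x y : chom W (excar (ex_initial2 f g))) :
  erel x y <-> erel (f \co x) (f \co y) /\ erel (g \co x) (g \co y).
Proof. exact: build_erelP. Qed.

Lemma ex_initial2_fst X Y Z (f : chom X (excar Y)) (g : chom X (excar Z)) :
  compatible (X := ex_initial2 f g) (Y := Y) f.
Proof. by move=> W x y /ex_initial2P[]. Qed.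
Arguments ex_initial2_fst : clear implicits.
Arguments ex_initial2_fst {X Y Z} f g.

Lemma ex_initial2_snd X Y Z (f : chom X (excar Y)) (g : chom X (excar Z)) :
  compatible (X := ex_initial2 f g) (Y := Z) g.
Proof. by move=> W x y /ex_initial2P[]. Qed.
Arguments ex_initial2_snd : clear implicits.
Arguments ex_initial2_snd {X Y Z} f g.

Lemma cls_comp (X Y Z : exobj C) (g : chom (excar Y) (excar Z))
    (f : chom (excar X) (excar Y)) (cg : compatible g) (cf : compatible f) :
  (cls cg : chom (Y : CX) Z) \co cls cf = cls (compatible_comp cg cf).
Proof.
apply: exhom_elt_ext => W x.
by rewrite -ccompA !cls_elt ccompA.
Qed.

Lemma ex_initial2_monic X Y Z (f : chom X (excar Y)) (g : chom X (excar Z)) :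
  jointly_monic (C := CX) (cls (ex_initial2_fst f g)) (cls (ex_initial2_snd f g)).
Proof.
move=> W u v; rewrite -(cls_rep u) -(cls_rep v) !cls_comp.
by move=> /cls_eqP fuv /cls_eqP guv; apply/cls_eqP/ex_initial2P.
Qed.

Lemma compatible_initial2 X Y Z (f : chom X (excar Y)) (g : chom X (excar Z))
    (W : exobj C) (h : chom (excar W) X) :
  compatible (X := W) (Y := Y) (f \co h) -> compatible (X := W) (Y := Z) (g \co h) ->
  compatible (X := W) (Y := ex_initial2 f g) h.
Proof.
move=> cf cg V x y xy; apply/ex_initial2P; rewrite !ccompA.
by split; [apply: cf | apply: cg].
Qed.

Lemma eq_compatible (X Y : exobj C) (f g : chom (excar X) (excar Y)) :
  erel f g -> compatible g -> compatible f.
Proof.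
move=> fg cg W x y xy; apply: erel_trans (erel_comp x fg) _.
by apply: erel_trans (cg _ _ _ xy) _; apply/erel_sym/erel_comp.
Qed.

Lemma Cex_terminal T : is_terminal T -> is_terminal (exdisc T : CX).
Proof.
move=> Tt X; have [t [_ tP]] := Tt (excar X).
have ct : compatible (X := X) (Y := exdisc T) t.
  move=> W x y _; apply/erel_disc; have [s [_ sP]] := Tt W.
  by rewrite -(sP (t \co x)) ?(sP (t \co y)).
exists (cls ct); split=> // h _.
by apply: (etrans _ (cls_rep h)); apply/cls_eqP/erel_eq/tP.
Qed.

(** The carrier weakly represents the pairs of elements of X and Y whose images in Z
are related. *)
Lemma Cex_pullback (X Y Z : CX) (f : chom X Z) (g : chom Y Z) :
  exists P (p : chom P X) (q : chom P Y), is_pullback f g p q.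
Proof.
have [L [l lP]] := covered_erel (rep f \co bfst (b := bp)) (rep g \co bsnd).
pose P := ex_initial2 (bfst \co l) (bsnd \co l).
pose p : chom (P : CX) X := cls (ex_initial2_fst (bfst \co l) (bsnd \co l)).
pose q : chom (P : CX) Y := cls (ex_initial2_snd (bfst \co l) (bsnd \co l)).
exists P, p, q; split.
  rewrite /p /q -{1}(cls_rep f) -{1}(cls_rep g) !cls_comp; apply/cls_eqP.
  by rewrite !ccompA; apply/lP; exists (idm _); rewrite ccomp1r.
move=> W u v; rewrite -{1}(cls_rep f) -{1}(cls_rep g) -{1}(cls_rep u) -{1}(cls_rep v).
rewrite !cls_comp => /cls_eqP fguv.
have [|k lk] := (lP _ (bpair bp (rep u) (rep v))).1.
  by rewrite -!ccompA bfst_pair bsnd_pair.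
have ku : bfst \co l \co k = rep u by rewrite -ccompA lk bfst_pair.
have kv : bsnd \co l \co k = rep v by rewrite -ccompA lk bsnd_pair.
have ck : compatible (X := W) (Y := P) k.
  apply: compatible_initial2.
    by apply: eq_compatible (erel_eq ku) (@rep_compatible _ _ _ u).
  by apply: eq_compatible (erel_eq kv) (@rep_compatible _ _ _ v).
have pk : p \co cls ck = u.
  by rewrite /p cls_comp; apply/(etrans _ (cls_rep u))/cls_eqP/erel_eq.
have qk : q \co cls ck = v.
  by rewrite /q cls_comp; apply/(etrans _ (cls_rep v))/cls_eqP/erel_eq.
exists (cls ck); split=> // h [hu hv].
apply: (ex_initial2_monic (f := bfst \co l) (g := bsnd \co l)).
  by move: hu; rewrite -pk.
by move: hv; rewrite -qk.
Qed.

Lemma Cex_finitely_complete : finitely_complete CX.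
Proof.
split; last exact: Cex_pullback.
case: Clex => -[T Tt] _; exists (exdisc T); exact: Cex_terminal.
Qed.

Lemma disc_compE (W : CX) X Y (f : chom X Y) (u : chom W (disc X)) (v : chom W (disc Y)) :
  fmap disc f \co u = v <-> f \co rep u = rep v.
Proof.
have e : erel (rep (fmap disc f \co u)) (f \co rep u).
  apply: erel_trans (erel_rep_comp _ _) _; apply: erel_comp; exact: rep_cls.
split=> [<- | fu]; first exact/esym/erel_disc.
by apply/exhom_eqP; apply: erel_trans e _; apply/erel_disc.
Qed.

Lemma rep_disc (X Y : C) (f : chom X Y) : rep (fmap disc f) = f.
Proof. by apply/erel_disc; apply: (rep_cls (Y := exdisc Y)). Qed.

Lemma disc_lex : lex_functor (@disc C).
Proof.
split; first exact: Cex_terminal.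
move=> X Y Z P f g p q pb; have pm := pullback_jointly_monic pb.
case: pb => fp pb; split; first by rewrite -!fmapM fp.
move=> W u v /disc_compE; rewrite -(disc_compE g v _).1 // => /pb[k [[pk qk] _]].
have ck : compatible (X := W) (Y := exdisc P) k.
  move=> V x y xy; apply/erel_disc; apply: pm.
    by rewrite !ccompA pk; apply/erel_disc; apply: rep_compatible.
  by rewrite !ccompA qk; apply/erel_disc; apply: rep_compatible.
have rk : rep (cls ck) = k by apply/erel_disc; apply: rep_cls.
exists (cls ck); split; first by split; apply/disc_compE; rewrite rk.
move=> h [/disc_compE hu /disc_compE hv]; apply/exhom_eqP/erel_disc.
by rewrite rk; apply: pm; rewrite ?pk ?qk.
Qed.

Definition elt_surjective (X Y : exobj C) (f : chom (X : CX) Y) :=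
  forall W (y : chom W (excar Y)), exists x : chom W (excar X),
    f \co elt x = elt y.

(** Lifting the generic element of Y gives a section s of f on carriers, up to the
relation of Y; it need not be compatible, but composing it with a morphism that
respects the kernel of f makes it so. *)
Lemma regular_epi_elt_surjective (X Y : CX) (f : chom X Y) :
  elt_surjective f -> regular_epi f.
Proof.
move=> fs; have [P [p [q pb]]] := Cex_pullback f f.
have [s fsE] := fs _ (idm _).
apply: (regular_epi_of_descend pb) => [Z u v uv | Z w wP].
  apply: exhom_elt_ext => W y; have [x <-] := fs W y.
  by rewrite !ccompA uv.
have [|h hP] := exhom_of_elt (X := Y) (Y := Z) (f := w \co elt s).
  move=> W x y xy; rewrite -!ccompA; apply: wP; rewrite !ccompA fsE.
  by rewrite !excover_elt; apply/elt_eqP.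
exists h; apply: exhom_elt_ext => W x.
rewrite -ccompA (comp_elt f) -(excover_elt (Y := Y)) ccompA hP -ccompA.
by apply: wP; rewrite ccompA fsE excover_elt -comp_elt.
Qed.

(** Discrete objects are projective with respect to regular epimorphisms. *)
Lemma elt_surjective_regular_epi (X Y : CX) (f : chom X Y) :
  regular_epi f -> elt_surjective f.
Proof.
move=> [R [a [b [fab cq]]]].
(* f factors through the object with carrier that of X and the relation
   reflected by f, and the second factor is monic, hence invertible. *)
pose I := ex_initial2 (rep f) (rep f).
pose m : chom (I : CX) Y := cls (ex_initial2_fst (rep f) (rep f)).
have cc : compatible (X := X) (Y := I) (idm (excar X)).
  by apply: compatible_initial2; rewrite ccomp1r; apply: rep_compatible.
have mc : m \co (cls cc : chom X I) = f.
  rewrite cls_comp; apply/(etrans _ (cls_rep f))/cls_eqP/erel_eq.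
  by rewrite ccomp1r.
have mm W (u v : chom W (I : CX)) : m \co u = m \co v -> u = v.
  move=> muv; apply: (@ex_initial2_monic _ _ _ (rep f) (rep f)) => //.
  by rewrite (_ : cls _ = m) //; apply/cls_eqP/erel_refl.
have [|h [hf _]] := cq _ (cls cc : chom X I).
  by apply: mm; rewrite !ccompA mc.
have mh : m \co h = idm Y.
  have [k [_ kP]] := cq _ f fab.
  apply: etrans (esym (kP _ _)) (kP _ _); last by rewrite ccomp1l.
  by rewrite -ccompA hf mc.
move=> W y; pose x : chom W (excar X) := rep (h \co elt y); exists x.
rewrite -(ccomp1l (elt y)) -mh -ccompA -(eltK (h \co elt y)).
rewrite comp_elt cls_elt; exact/elt_eqP/erel_refl.
Qed.

Lemma regular_epi_excover (Y : exobj C) : regular_epi (excover Y).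
Proof.
by apply: regular_epi_elt_surjective => W y; exists y; rewrite excover_elt.
Qed.

Section EquivalenceRelation.
Variables (R X : CX) (r1 r2 : chom R X) (eqR : equivalence_relation r1 r2).

(** An equivalence relation in the completion, restricted to morphisms from discrete
objects, is covered by the carrier of R, so it defines the quotient directly. *)
Definition eqrel_rel W (x y : chom W (excar X)) :=
  exists rho : chom (exdisc W : CX) R, r1 \co rho = elt x /\ r2 \co rho = elt y.

Lemma eqrel_equivalence : stagewise_equivalence eqrel_rel.
Proof.
case: eqR => _ [d [d1 d2]] [s [s1 s2]] tr; split=> W.
- by move=> x; exists (d \co elt x); rewrite !ccompA d1 d2 !ccomp1l.
- by move=> x y [k [kx ky]]; exists (s \co k); rewrite !ccompA s1 s2.
- move=> x y z [k [kx ky]] [l [ly lz]].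
  have [P [p [q pb]]] := Cex_pullback r2 r1.
  have [t [t1 t2]] := tr _ _ _ pb.
  have [|h [[hp hq] _]] := pb.2 _ k l; first by rewrite ky ly.
  exists (t \co h); rewrite !ccompA t1 t2 -!ccompA hp hq.
  by split.
Qed.

Lemma eqrel_covered : covered (fun W (p : chom W (bprod bp (excar X) (excar X))) =>
  eqrel_rel (bfst \co p) (bsnd \co p)).
Proof.
pose A W (p : chom W (bprod bp (bprod bp (excar X) (excar X)) (excar R))) :=
  erel (rep r1 \co bsnd \co p) (bfst \co bfst \co p) /\
  erel (rep r2 \co bsnd \co p) (bsnd \co bfst \co p).
have Acov : covered A by apply: (covered_and Clex); apply: covered_erel.
apply: eq_covered (covered_ex Acov) => W p; split.
  move=> [rho []]; rewrite -!ccompA bfst_pair bsnd_pair => e1 e2.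
  by exists (elt rho); rewrite !comp_elt; split; apply/elt_eqP.
move=> [k []]; rewrite -(eltK k) !comp_elt => /elt_eqP e1 /elt_eqP e2.
by exists (rep k); rewrite /A -!ccompA bfst_pair bsnd_pair.
Qed.

Definition ex_quotient : exobj C := build_exobj eqrel_covered eqrel_equivalence.

Lemma ex_quotientP W (x y : chom W (excar ex_quotient)) : erel x y <-> eqrel_rel x y.
Proof. exact: build_erelP. Qed.

Lemma ex_quotient_compatible : compatible (X := X) (Y := ex_quotient) (idm (excar X)).
Proof.
move=> W x y xy; rewrite !ccomp1l; apply/ex_quotientP.
have [k [k1 k2]] : eqrel_rel x x by case: eqrel_equivalence => er _ _; apply: er.
by exists k; split=> //; rewrite k2; apply/elt_eqP.
Qed.

Definition ex_quotient_map : chom X ex_quotient := cls ex_quotient_compatible.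

Lemma ex_quotient_map_elt W (x : chom W (excar X)) :
  ex_quotient_map \co elt x = elt (Y := ex_quotient) x.
Proof. by rewrite cls_elt ccomp1l. Qed.

Lemma ex_quotient_regular_epi : regular_epi ex_quotient_map.
Proof.
apply: regular_epi_elt_surjective => W y; exists y.
exact: ex_quotient_map_elt.
Qed.

Lemma ex_quotient_kernel_pair : is_pullback ex_quotient_map ex_quotient_map r1 r2.
Proof.
case: (eqR) => rm _ _ _; split.
  apply: exhom_elt_ext => W x.
  rewrite -!ccompA (comp_elt r1) (comp_elt r2) !ex_quotient_map_elt.
  by apply/elt_eqP/ex_quotientP; exists (elt x); rewrite !comp_elt.
move=> W u v uv.
have [k [k1 k2]] : eqrel_rel (rep u) (rep v).
  apply/ex_quotientP/elt_eqP; rewrite -!ex_quotient_map_elt.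
  have := congr1 (fun h => h \co excover W) uv.
  by rewrite -!ccompA /excover (comp_elt u) (comp_elt v) !ccomp1r.
have [||h [h1 h2]] := jointly_monic_local rm (regular_epi_excover W)
  (h := k) (x := u) (y := v).
- by rewrite k1 comp_elt ccomp1r.
- by rewrite k2 comp_elt ccomp1r.
exists h; split=> // h' [h'1 h'2]; apply: rm; first by rewrite h1 h'1.
by rewrite h2 h'2.
Qed.

End EquivalenceRelation.

Lemma Cex_exact : exact_category CX.
Proof.
split; last first.
  move=> R X r1 r2 eqR; exists (ex_quotient eqR), (ex_quotient_map eqR).
  exact: ex_quotient_kernel_pair.
split; first exact: Cex_finitely_complete.
  move=> X Y P f p q /kernel_pair_equivalence eqR.
  exists (ex_quotient eqR), (ex_quotient_map eqR).
  exact: coequalizer_kernel_pair (ex_quotient_regular_epi _) (ex_quotient_kernel_pair _).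
move=> X Y Z P f g p q [fp pb] /elt_surjective_regular_epi fs.
apply: regular_epi_elt_surjective => W y.
have [x fx] := fs _ (rep (g \co elt y)).
have [|h [[_ hq] _]] := pb _ (elt x) (elt y); first by rewrite fx eltK.
by exists (rep h); rewrite eltK.
Qed.

End Exactness.

(** * Extending lex functors along the completion *)

Section Image.
Variables (A : category) (Areg : regular_category A).

(** Image factorisation of a span: I is the coequalizer of the kernel pair of the
induced morphism into the product. *)
Lemma regular_image R X Y (r1 : chom R X) (r2 : chom R Y) :
  exists (I : A) (c : chom R I) (i1 : chom I X) (i2 : chom I Y),
    [/\ regular_epi c, jointly_monic i1 i2, i1 \co c = r1 & i2 \co c = r2].
Proof.
case: (Areg) => Alex coeq _.
have [bp] := choose_products (finitely_complete_product Alex).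
have [P [p [q pb]]] := regular_pullback Areg (bpair bp r1 r2) (bpair bp r1 r2).
have [I [c cq]] := coeq _ _ _ _ _ _ pb.
have rc : regular_epi c by exists P, p, q.
have [i [ic _]] := cq.2 _ _ pb.1.
have i1c : bfst \co i \co c = r1 by rewrite -ccompA ic bfst_pair.
have i2c : bsnd \co i \co c = r2 by rewrite -ccompA ic bsnd_pair.
exists I, c, (bfst \co i), (bsnd \co i); split=> // W u v uv1 uv2.
have iuv : i \co u = i \co v by apply: (bprod_monic (b := bp)); rewrite !ccompA.
have [W1 [e1 [x [re1 cx]]]] := regular_epi_lift Areg u rc.
have [W2 [e2 [y [re2 cy]]]] := regular_epi_lift Areg (v \co e1) rc.
apply: (regular_epi_epi re1); apply: (regular_epi_epi re2).
have [|k [[kx ky] _]] := pb.2 _ (x \co e2) y.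
  by rewrite -ic -!ccompA cy !(ccompA c) cx !ccompA iuv.
by rewrite -cy -ky -cx -ccompA -kx !ccompA cq.1.
Qed.

End Image.

Section Extension.
Variables (C : category) (Clex : finitely_complete C) (bp : binary_products C).
Variables (A : category) (Aexact : exact_category A).
Variables (F : functor C A) (Flex : lex_functor F).
Let Areg : regular_category A := Aexact.1.

(** F preserves products, in the form of pairing here and of joint monicity next,
because products are pullbacks over a terminal object. *)
Lemma lex_pair_exists (X Y : C) W (u : chom W (F X)) (v : chom W (F Y)) :
  exists h : chom W (F (bprod bp X Y)),
    fmap F bfst \co h = u /\ fmap F bsnd \co h = v.
Proof.
case: (Clex) => -[T Tt] pbC; case: Flex => Ft Fpb.
have [f _] := Tt X; have [g _] := Tt Y.
have [P [p [q pb]]] := pbC _ _ _ f g.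
have [_ Fp] := Fpb _ _ _ _ _ _ _ _ pb.
have [|h [[<- <-] _]] := Fp _ u v.
  by have [t [_ tP]] := Ft _ Tt W; rewrite -(tP (fmap F f \co u)) // -(tP (fmap F g \co v)).
exists (fmap F (bpair bp p q) \co h).
by rewrite !ccompA -!fmapM bfst_pair bsnd_pair.
Qed.

Lemma lex_pair_monic (X Y : C) :
  jointly_monic (fmap F (bfst (b := bp) (X := X) (Y := Y))) (fmap F bsnd).
Proof.
case: (Clex) => -[T Tt] _; case: Flex => _ Fpb.
have [f _] := Tt X; have [g _] := Tt Y.
apply: (@pullback_jointly_monic _ _ _ _ _ (fmap F f) (fmap F g)); apply: Fpb.
split=> [|W u v _]; last exact: is_product_bprod.
by have [t [_ tP]] := Tt (bprod bp X Y); rewrite -(tP (f \co bfst)) // -(tP (g \co bsnd)).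
Qed.

(** The interpretation in A of a predicate on generalised elements of P in C: locally,
x comes from an element of P that satisfies it. This lets properties of C_ex, which
hold for elements at stages in C, be applied to elements at stages in A. *)
Definition forces (P : C) (Q : forall W, chom W P -> Prop) W (x : chom W (F P)) :=
  exists W' (e : chom W' W) R (r : chom R P) (rho : chom W' (F R)),
    [/\ regular_epi e, Q R r & fmap F r \co rho = x \co e].

Lemma forces_impl (P : C) (Q Q' : forall W, chom W P -> Prop) W (x : chom W (F P)) :
  (forall W y, Q W y -> Q' W y) -> forces Q x -> forces Q' x.
Proof.
move=> QQ' [W' [e [R [r [rho [re Qr rx]]]]]].
by exists W', e, R, r, rho; split=> //; apply: QQ'.
Qed.

Lemma forces_and (P : C) (Q Q' : forall W, chom W P -> Prop) W (x : chom W (F P)) :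
  covered Q -> covered Q' ->
  forces Q x -> forces Q' x -> forces (fun W y => Q W y /\ Q' W y) x.
Proof.
move=> cQ cQ' [W1 [e1 [R [r [rho [re1 Qr rx]]]]]] [W2 [e2 [S [s [sig [re2 Qs sx]]]]]].
have [W3 [e3 [k [re3 ke]]]] := regular_epi_lift Areg e1 re2.
case: (Clex) => _ /(_ _ _ _ r s)[L [p [q pb]]].
have [_ Fpb] := Flex.2 _ _ _ _ _ _ _ _ pb.
have [|h [[hp hq] _]] := Fpb _ (rho \co e3) (sig \co k).
  by rewrite !ccompA rx sx -!ccompA ke.
exists W3, (e1 \co e3), L, (r \co p), h; split.
- exact: regular_epi_comp.
- split; first exact: covered_stable cQ _ _ _ _ Qr.
  by rewrite pb.1; apply: covered_stable cQ' _ _ _ _ Qs.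
- by rewrite fmapM -ccompA hp ccompA rx ccompA.
Qed.

(** The relation on the generalised elements of F X induced by a
pseudo-equivalence relation on X, namely its image. *)
Definition Frel (X : exobj C) W (u v : chom W (F (excar X))) :=
  exists W' (e : chom W' W), regular_epi e /\
    span_rel (fmap F (ex1 X)) (fmap F (ex2 X)) (u \co e) (v \co e).

Lemma Frel_of_forces (P : C) (X : exobj C) (f g : chom P (excar X)) W
    (x : chom W (F P)) :
  forces (fun W y => erel (f \co y) (g \co y)) x ->
  Frel (X := X) (fmap F f \co x) (fmap F g \co x).
Proof.
move=> [W' [e [R [r [rho [re [th [th1 th2]] rx]]]]]].
exists W', e; split=> //; exists (fmap F th \co rho).
by rewrite !ccompA -!fmapM th1 th2 !fmapM -!ccompA rx.
Qed.

(** A converse of the previous lemma: F preserves the pullback that classifies the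
elements y of P together with a witness that f y and g y are related. *)
Lemma forces_of_Frel (P : C) (X : exobj C) (f g : chom P (excar X)) W
    (x : chom W (F P)) :
  Frel (X := X) (fmap F f \co x) (fmap F g \co x) ->
  forces (fun W y => erel (f \co y) (g \co y)) x.
Proof.
move=> [W' [e [re [rho [rho1 rho2]]]]].
case: (Clex) => _ /(_ _ _ _ (bpair bp f g) (bpair bp (ex1 X) (ex2 X))).
move=> [L [p [q pb]]]; have [_ Fpb] := Flex.2 _ _ _ _ _ _ _ _ pb.
have [|h [[hp hq] _]] := Fpb _ (x \co e) rho.
  apply: lex_pair_monic; rewrite !ccompA -!fmapM ?bfst_pair ?bsnd_pair.
    by rewrite rho1.
  by rewrite rho2.
exists W', e, L, p, h; split=> //; exists q.
move: pb.1; rewrite !bpair_comp => E; split.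
  by have := congr1 (fun z => bfst \co z) E; rewrite !bfst_pair.
by have := congr1 (fun z => bsnd \co z) E; rewrite !bsnd_pair.
Qed.

Lemma Frel_erel (X : exobj C) (P : C) (f g : chom P (excar X)) W (x : chom W (F P)) :
  erel f g -> Frel (X := X) (fmap F f \co x) (fmap F g \co x).
Proof.
move=> fg; apply: Frel_of_forces.
exists W, (idm W), P, (idm P), x; split; first exact: regular_epi_id.
  by rewrite !ccomp1r.
by rewrite fmap1 ccomp1l ccomp1r.
Qed.

Section Quotient.
Variable X : exobj C.
Local Notation X0 := (excar X).
Local Notation r1 := (fmap F (ex1 X)).
Local Notation r2 := (fmap F (ex2 X)).

Lemma Frel_span_refl : span_rel r1 r2 (idm (F X0)) (idm (F X0)).
Proof.
have [d [d1 d2]] : erel (idm X0) (idm X0) by apply: erel_refl.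
by exists (fmap F d); rewrite -!fmapM d1 d2 fmap1.
Qed.

Lemma Frel_span_sym : span_rel r1 r2 r2 r1.
Proof.
have [s [s1 s2]] : erel (ex2 X) (ex1 X) by apply/erel_sym/erel_gen.
by exists (fmap F s); rewrite -!fmapM s1 s2.
Qed.

Lemma Frel_span_trans W (rho sig : chom W (F (exrel X))) :
  r2 \co rho = r1 \co sig -> span_rel r1 r2 (r1 \co rho) (r2 \co sig).
Proof.
move=> rs; case: (Clex) => _ /(_ _ _ _ (ex2 X) (ex1 X))[L [p [q pb]]].
have [_ Fpb] := Flex.2 _ _ _ _ _ _ _ _ pb.
have [|h [[hp hq] _]] := Fpb _ rho sig; first exact: rs.
have [t [t1 t2]] : erel (ex1 X \co p) (ex2 X \co q).
  apply: (erel_trans (y := ex2 X \co p)); first exact/erel_comp/erel_gen.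
  by rewrite pb.1; exact/erel_comp/erel_gen.
exists (fmap F t \co h).
by rewrite !ccompA -!fmapM t1 t2 !fmapM -!ccompA hp hq.
Qed.

(** The image of the span F R -> F X is an equivalence relation, and effective since A
is exact; the transitivity of R only yields local witnesses, which suffice because an
image is jointly monic. *)
Lemma quotient_exists : exists (Q : A) (q : chom (F X0) Q), regular_epi q /\
  forall W (u v : chom W (F X0)), q \co u = q \co v <-> Frel (X := X) u v.
Proof.
have [I [c [i1 [i2 [rc im i1c i2c]]]]] := regular_image Areg r1 r2.
have eqI : equivalence_relation i1 i2.
  split=> //.
  - have [d [d1 d2]] := Frel_span_refl.
    by exists (c \co d); rewrite !ccompA i1c i2c.
  - have [s [s1 s2]] := Frel_span_sym.
    apply: (jointly_monic_local im rc (h := c \co s)).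
      by rewrite ccompA i1c s1 i2c.
    by rewrite ccompA i2c s2 i1c.
  - move=> P p q pb.
    have [W1 [e1 [x [re1 cx]]]] := regular_epi_lift Areg p rc.
    have [W2 [e2 [y [re2 cy]]]] := regular_epi_lift Areg (q \co e1) rc.
    have [|t [t1 t2]] := @Frel_span_trans _ (x \co e2) y.
      rewrite -i2c -i1c -!ccompA cy !(ccompA c) cx !ccompA.
      by rewrite (pb.1).
    have re := regular_epi_comp Areg re1 re2.
    apply: (jointly_monic_local im re (h := c \co t)).
      by rewrite ccompA i1c t1 -i1c -!ccompA (ccompA c) cx -ccompA.
    by rewrite ccompA i2c t2 -i2c -ccompA cy !ccompA.
have [Y [f pb]] := Aexact.2 _ _ _ _ eqI.
have [Q [q cq]] : exists Q (q : chom (F X0) Q), is_coequalizer i1 i2 q.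
  by case: Areg => _ coeq _; apply: coeq pb.
have [g [gq _]] := cq.2 _ f pb.1.
exists Q, q; split=> [|W u v]; first by exists I, i1, i2.
split=> [quv | [W' [e [re [rho [rho1 rho2]]]]]].
  have [|k [[<- <-] _]] := pb.2 _ u v; first by rewrite -gq -!ccompA quv.
  have [W' [e [x [re cx]]]] := regular_epi_lift Areg k rc.
  exists W', e; split=> //; exists x.
  by rewrite -i1c -i2c -!ccompA cx.
apply: (regular_epi_epi re).
by rewrite -!ccompA -rho1 -rho2 -i1c -i2c !ccompA cq.1.
Qed.

End Quotient.

Definition extend_obj (X : exobj C) : A := projT1 (boolp.cid (quotient_exists X)).
Definition quo (X : exobj C) : chom (F (excar X)) (extend_obj X) :=
  projT1 (boolp.cid (projT2 (boolp.cid (quotient_exists X)))).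

Lemma quo_regular_epi X : regular_epi (quo X).
Proof. by case: (projT2 (boolp.cid (projT2 (boolp.cid (quotient_exists X))))). Qed.

Lemma quo_eqP X W (u v : chom W (F (excar X))) :
  quo X \co u = quo X \co v <-> Frel (X := X) u v.
Proof. by case: (projT2 (boolp.cid (projT2 (boolp.cid (quotient_exists X))))) => _. Qed.

Lemma quo_erel X P (f g : chom P (excar X)) :
  erel f g -> quo X \co fmap F f = quo X \co fmap F g.
Proof.
move=> /(Frel_erel (idm (F P))); rewrite !ccomp1r.
by move/quo_eqP.
Qed.

Lemma extend_map_exists (X Y : exobj C) (h : exhom X Y) :
  exists g : chom (extend_obj X) (extend_obj Y), g \co quo X = quo Y \co fmap F (rep h).
Proof.
apply: (regular_epi_descend (quo_regular_epi X)) => W a b /quo_eqP.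
move=> [W' [e [re [rho [rho1 rho2]]]]]; apply: (regular_epi_epi re).
rewrite -!ccompA -rho1 -rho2 !(ccompA (fmap F (rep h))) -!fmapM !ccompA.
congr (_ \co _); apply: quo_erel; apply: rep_compatible; exact: erel_gen.
Qed.

Definition extend_map (X Y : exobj C) (h : exhom X Y) : chom (extend_obj X) (extend_obj Y) :=
  projT1 (boolp.cid (extend_map_exists h)).

Lemma extend_map_quo X Y (h : exhom X Y) : extend_map h \co quo X = quo Y \co fmap F (rep h).
Proof. exact: projT2 (boolp.cid (extend_map_exists h)). Qed.

Lemma extend_map1 (X : Cex C) : extend_map (idm X) = idm (extend_obj X).
Proof.
apply: (regular_epi_epi (quo_regular_epi X)).
rewrite extend_map_quo ccomp1l (quo_erel (g := idm _)); last exact: rep_cls.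
by rewrite fmap1 ccomp1r.
Qed.

Lemma extend_mapM (X Y Z : Cex C) (g : chom Y Z) (f : chom X Y) :
  extend_map (g \co f) = extend_map g \co extend_map f.
Proof.
apply: (regular_epi_epi (quo_regular_epi X)).
rewrite extend_map_quo -ccompA extend_map_quo ccompA extend_map_quo -ccompA -fmapM.
exact/quo_erel/erel_rep_comp.
Qed.

Definition extend : functor (Cex C) A :=
  @Functor (Cex C) A extend_obj extend_map extend_map1 extend_mapM.

(** All elements of the carrier of a terminal object are related to each other. *)
Lemma extend_terminal (X : Cex C) : is_terminal X -> is_terminal (extend X).
Proof.
move=> Xt; case: (Clex) => -[T Tt] pbC; case: (Flex) => Ft Fpb.
have all_rel W (x y : chom W (excar X)) : erel x y.
  apply/elt_eqP; have [t [_ tP]] := Xt (exdisc W).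
  by rewrite -(tP (elt x)) // -(tP (elt y)).
have [t _] := Xt (exdisc T).
move=> W; have [w _] := Ft _ Tt W.
exists (quo X \co fmap F (rep t) \co w); split=> // v _.
set u := _ \co w.
have [W1 [e1 [x [re1 cx]]]] := regular_epi_lift Areg u (quo_regular_epi X).
have [W2 [e2 [y [re2 cy]]]] := regular_epi_lift Areg (v \co e1) (quo_regular_epi X).
apply: (regular_epi_epi re1); apply: (regular_epi_epi re2).
rewrite -cx -cy -ccompA.
have [h [<- <-]] := lex_pair_exists (x \co e2) y.
by rewrite !ccompA; congr (_ \co _); apply: quo_erel.
Qed.

Section PreservesPullbacks.
Variables (X Y Z P : Cex C) (f : chom X Z) (g : chom Y Z).
Variables (p : chom P X) (q : chom P Y) (pb : is_pullback f g p q).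

(** In C, elements of P whose images in X and in Y are related are themselves related;
forcing transports this implication to A. *)
Lemma extend_pullback_monic : jointly_monic (fmap extend p) (fmap extend q).
Proof.
move=> W u v pu qu.
have [W1 [e1 [x [re1 cx]]]] := regular_epi_lift Areg u (quo_regular_epi P).
have [W2 [e2 [y [re2 cy]]]] := regular_epi_lift Areg (v \co e1) (quo_regular_epi P).
apply: (regular_epi_epi re1); apply: (regular_epi_epi re2).
have [h [hx hy]] := lex_pair_exists (x \co e2) y.
have step (S : Cex C) (s : chom P S) : fmap extend s \co u = fmap extend s \co v ->
    forces (fun W (z : chom W (bprod bp _ _)) =>
      erel (rep s \co bfst \co z) (rep s \co bsnd \co z)) h.
  move=> suv; apply: forces_of_Frel; apply/quo_eqP.
  rewrite !fmapM -!ccompA hx hy !ccompA -!extend_map_quo -!ccompA cy (ccompA (quo P)) cx.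
  by rewrite !ccompA suv.
have /(forces_impl (Q' := fun W (z : chom W (bprod bp _ _)) =>
    erel (X := P) (bfst \co z) (bsnd \co z))) : forces _ h :=
  forces_and (covered_erel Clex bp _ _) (covered_erel Clex bp _ _)
    (step _ _ pu) (step _ _ qu).
move=> /(_ _)/Frel_of_forces; rewrite hx hy => xy.
rewrite -cx -cy -ccompA; apply/quo_eqP/xy => W' z [].
rewrite -!ccompA => zp zq; apply/elt_eqP.
by apply: (pullback_jointly_monic pb); rewrite !comp_elt; apply/elt_eqP.
Qed.

Lemma extend_pullback :
  is_pullback (fmap extend f) (fmap extend g) (fmap extend p) (fmap extend q).
Proof.
split=> [|W u v uv]; first by rewrite -!fmapM pb.1.
suff [k [k1 k2]] : exists k : chom W (extend P),
    fmap extend p \co k = u /\ fmap extend q \co k = v.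
  by exists k; split=> // k' [k'1 k'2]; apply: extend_pullback_monic; rewrite ?k1 ?k2.
have [W1 [e1 [x [re1 cx]]]] := regular_epi_lift Areg u (quo_regular_epi X).
have [W2 [e2 [y [re2 cy]]]] := regular_epi_lift Areg (v \co e1) (quo_regular_epi Y).
have [h [hx hy]] := lex_pair_exists (x \co e2) y.
have : forces (fun W (z : chom W (bprod bp _ _)) =>
    erel (X := Z) (rep f \co bfst \co z) (rep g \co bsnd \co z)) h.
  apply: forces_of_Frel; apply/quo_eqP.
  rewrite !fmapM -!ccompA hx hy !ccompA -!extend_map_quo -!ccompA cy (ccompA (quo X)) cx.
  by rewrite !ccompA uv.
move=> [W3 [e3 [R [r [rho [re3 Er rh]]]]]].
have [|t [[t1 t2] _]] := pb.2 _ (elt (bfst \co r)) (elt (bsnd \co r)).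
  by rewrite !comp_elt; apply/elt_eqP; rewrite !ccompA.
have re := regular_epi_comp Areg (regular_epi_comp Areg re1 re2) re3.
apply: (jointly_monic_local extend_pullback_monic re
         (h := quo P \co fmap F (rep t) \co rho)).
  rewrite !ccompA extend_map_quo -(ccompA (quo X)) -fmapM.
  rewrite (quo_erel (g := bfst \co r)).
    rewrite fmapM -!ccompA rh (ccompA _ h) hx -ccompA (ccompA _ x) cx.
    by rewrite -!ccompA.
  by apply/elt_eqP; rewrite -comp_elt eltK.
rewrite !ccompA extend_map_quo -(ccompA (quo Y)) -fmapM.
rewrite (quo_erel (g := bsnd \co r)).
  rewrite fmapM -!ccompA rh (ccompA _ h) hy (ccompA _ y) cy.
  by rewrite -!ccompA.
by apply/elt_eqP; rewrite -comp_elt eltK.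
Qed.

End PreservesPullbacks.

(** A regular epimorphism of the completion has a section on carriers up to the
relation of the target, and F preserves such data. *)
Lemma extend_regular : regular_functor extend.
Proof.
split; first by split; [exact: extend_terminal | exact: extend_pullback].
move=> X Y f /(elt_surjective_regular_epi Clex bp) fs.
have [s fsE] := fs _ (idm _).
apply: (regular_epi_of_comp Areg (x := quo X \co fmap F s)).
rewrite ccompA extend_map_quo -ccompA -fmapM (quo_erel (g := idm _)).
  by rewrite fmap1 ccomp1r; exact: quo_regular_epi.
by apply/elt_eqP; rewrite -comp_elt.
Qed.

(** The quotient of F X by the diagonal is F X. *)
Lemma extend_disc_iso : naturally_isomorphic (functor_comp extend disc) F.
Proof.
have sP X : exists s : chom (extend (disc X)) (F X), s \co quo (disc X) = idm (F X).
  apply: (regular_epi_descend (quo_regular_epi (disc X))) => W a b.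
  move=> /quo_eqP[W' [e [re [rho [rho1 rho2]]]]].
  by apply: (regular_epi_epi re); rewrite !ccomp1l -rho1 -rho2.
pose s X := projT1 (boolp.cid (sP X)).
have sq X : s X \co quo (disc X) = idm (F X) := projT2 (boolp.cid (sP X)).
have qs X : quo (disc X) \co s X = idm (extend (disc X)).
  apply: (regular_epi_epi (quo_regular_epi (disc X))).
  by rewrite -ccompA sq ccomp1l ccomp1r.
have nq X Y (f : chom X Y) :
    quo (disc Y) \co fmap F f = fmap extend (fmap disc f) \co quo (disc X).
  by rewrite extend_map_quo rep_disc.
exists s, (fun X => quo (disc X)); split=> // X Y f /=.
apply: (regular_epi_epi (quo_regular_epi (disc X))).
by rewrite -!ccompA -nq sq ccompA sq ccomp1l ccomp1r.
Qed.

End Extension.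

(** * The universal property *)

Section NaturalExtension.
Variables (C : category) (Clex : finitely_complete C) (bp : binary_products C).
Variables (A : category) (Aexact : exact_category A).
Let Areg : regular_category A := Aexact.1.

(** The kernel pair of the cover of Y by a discrete object is itself covered by the
discrete object on the carrier of the relation; regular functors preserve this. *)
Lemma regular_functor_kernel (G : functor (Cex C) A) (Y : exobj C) W
    (a b : chom W (G (disc (excar Y)))) :
  regular_functor G ->
  fmap G (excover Y) \co a = fmap G (excover Y) \co b ->
  exists W' (e : chom W' W), regular_epi e /\
    span_rel (fmap G (fmap disc (ex1 Y))) (fmap G (fmap disc (ex2 Y))) (a \co e) (b \co e).
Proof.
move=> [[_ Gpb] Gre] ab.
have [K [k1 [k2 pb]]] := Cex_pullback Clex bp (excover Y) (excover Y).
have km := pullback_jointly_monic pb.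
have [|w [[w1 w2] _]] := pb.2 _ (fmap disc (ex1 Y)) (fmap disc (ex2 Y)).
  by rewrite !excover_elt; apply/elt_eqP/erel_gen.
have rw : regular_epi w.
  apply: (regular_epi_elt_surjective Clex bp) => V z.
  have [rho [rho1 rho2]] : erel (X := Y) (rep (k1 \co elt z)) (rep (k2 \co elt z)).
    by apply/elt_eqP; rewrite -[LHS]excover_elt -[RHS]excover_elt !eltK !ccompA pb.1.
  exists rho; apply: km; rewrite ccompA ?w1 ?w2 elt_disc.
    by rewrite rho1 eltK.
  by rewrite rho2 eltK.
have [|h [[ha hb] _]] := (Gpb _ _ _ _ _ _ _ _ pb).2 _ a b; first exact: ab.
have [W' [e [x [re wx]]]] := regular_epi_lift Areg h (Gre _ _ _ rw).
exists W', e; split=> //; exists x.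
by rewrite -w1 -w2 !fmapM -!ccompA wx !ccompA ha hb.
Qed.

Variables (G H : functor (Cex C) A) (Gr : regular_functor G) (Hr : regular_functor H).
Variable s : forall X, chom (functor_comp G disc X) (functor_comp H disc X).
Hypothesis snat : natural s.

(** The component at Y is forced on the cover of Y by a discrete object; it descends
because s is natural with respect to the two morphisms ex1 Y and ex2 Y. *)
Lemma extension_component (Y : exobj C) : exists t : chom (G Y) (H Y),
  t \co fmap G (excover Y) = fmap H (excover Y) \co s (excar Y).
Proof.
have Gc := Gr.2 _ _ _ (regular_epi_excover Clex bp Y).
apply: (regular_epi_descend Gc) => W a b ab.
have [W' [e [re [rho [rho1 rho2]]]]] := regular_functor_kernel Gr ab.
apply: (regular_epi_epi re); rewrite -!ccompA -rho1 -rho2 !(ccompA (s _)).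
have E f : s (excar Y) \co fmap G (fmap disc f) = fmap H (fmap disc f) \co s (exrel Y).
  exact: snat.
rewrite !E !ccompA -!fmapM; do 2 congr (_ \co _).
by rewrite !excover_elt; congr (fmap H _); apply/elt_eqP/erel_gen.
Qed.

Lemma natural_extension : exists! t : forall Y, chom (G Y) (H Y),
  natural t /\ forall X, t (disc X) = s X.
Proof.
have Gc Y : regular_epi (fmap G (excover Y)).
  exact: Gr.2 (regular_epi_excover Clex bp Y).
have cover_disc X : excover (exdisc X) = idm (disc X : Cex C).
  by apply/cls_eqP/erel_refl.
pose t Y := projT1 (boolp.cid (extension_component Y)).
have tP Y : t Y \co fmap G (excover Y) = fmap H (excover Y) \co s (excar Y) :=
  projT2 (boolp.cid (extension_component Y)).
have cover_nat (X Y : Cex C) (f : chom X Y) :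
    f \co excover X = excover Y \co fmap disc (rep f).
  by rewrite excover_elt /excover comp_elt ccomp1r.
exists t; split; first split.
- move=> X Y f; apply: (regular_epi_epi (Gc X)).
  rewrite -!ccompA tP -fmapM cover_nat fmapM !ccompA tP -fmapM cover_nat fmapM.
  by rewrite -!ccompA; congr (_ \co _); apply: snat.
- move=> X; have := tP (disc X); rewrite cover_disc !fmap1 ccomp1l.
  by rewrite (ccomp1r (t _)).
move=> t' [t'nat t'disc]; apply: functional_extensionality_dep => Y.
by apply: (regular_epi_epi (Gc Y)); rewrite tP -(t'disc (excar Y)) t'nat.
Qed.

End NaturalExtension.

Theorem Cex_exact_completion (C : category) :
  finitely_complete C -> is_exact_completion (@disc C).
Proof.
move=> Clex; have [bp] := choose_products (finitely_complete_product Clex).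
split=> //; [exact: (Cex_exact Clex bp) | exact: disc_lex | |].
  move=> A Aex F Flex; exists (extend Clex Aex Flex).
  by split; [exact: (extend_regular Clex bp) | exact: extend_disc_iso].
move=> A Aex G H Gr Hr s snat; exact: (natural_extension Clex bp).
Qed.

(** * Uniqueness of the exact completion *)

Definition functor_id (C : category) : functor C C :=
  @Functor C C (fun X => X) (fun X Y f => f)
    (fun X => erefl) (fun X Y Z g f => erefl).

Lemma regular_functor_id C : regular_functor (functor_id C).
Proof. by []. Qed.

Lemma regular_functor_comp (C D E : category) (G : functor D E) (F : functor C D) :
  regular_functor G -> regular_functor F -> regular_functor (functor_comp G F).
Proof.
move=> [[Gt Gp] Gr] [[Ft Fp] Fr]; split; last by move=> X Y q /Fr/Gr.
split; first by move=> X /Ft/Gt.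
by move=> X Y Z P f g p q /Fp/Gp.
Qed.

Section Uniqueness.
Variables (C E : category) (J : functor C E) (Jex : is_exact_completion J).

(** Extending s and t gives transformations whose composites extend identities, and
identities are the unique such extensions. *)
Lemma exact_completion_iso (A : category) (G H : functor E A) :
  exact_category A -> regular_functor G -> regular_functor H ->
  naturally_isomorphic (functor_comp G J) (functor_comp H J) ->
  naturally_isomorphic G H.
Proof.
case: Jex => _ _ _ _ ff Aex Gr Hr [s [t [sn tn ts st]]].
have [s' [[s'n s'J] _]] := ff A Aex G H Gr Hr s sn.
have [t' [[t'n t'J] _]] := ff A Aex H G Hr Gr t tn.
exists s', t'; split=> // Y.
- have [u [_ uP]] := ff A Aex G G Gr Gr (fun X => idm (G (J X)))
    (fun X Y f => etrans (ccomp1l _) (esym (ccomp1r _))).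
  have u1 : u = fun Y => idm (G Y).
    by apply: uP; split=> // X Z f; rewrite ccomp1l ccomp1r.
  suff u2 : u = fun Y => t' Y \co s' Y by exact: (congr1 (fun w => w Y) (etrans (esym u2) u1)).
  apply: uP; split=> [X Z f | X]; last by rewrite s'J t'J; apply: ts.
  by rewrite -ccompA s'n ccompA t'n ccompA.
- have [u [_ uP]] := ff A Aex H H Hr Hr (fun X => idm (H (J X)))
    (fun X Y f => etrans (ccomp1l _) (esym (ccomp1r _))).
  have u1 : u = fun Y => idm (H Y).
    by apply: uP; split=> // X Z f; rewrite ccomp1l ccomp1r.
  suff u2 : u = fun Y => s' Y \co t' Y by exact: (congr1 (fun w => w Y) (etrans (esym u2) u1)).
  apply: uP; split=> [X Z f | X]; last by rewrite s'J t'J; apply: st.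
  by rewrite -ccompA t'n ccompA s'n ccompA.
Qed.

Lemma exact_completion_endo (K : functor E E) : regular_functor K ->
  naturally_isomorphic (functor_comp K J) J -> naturally_isomorphic K (functor_id E).
Proof.
move=> Kr [s [t [sn tn ts st]]].
case: (Jex) => _ Eex _ _ _.
apply: exact_completion_iso Eex Kr (@regular_functor_id E) _.
by exists s, t.
Qed.

End Uniqueness.

Lemma naturally_isomorphic_comp (C D E : category) (F : functor C D)
    (G : functor D E) (F' : functor C D) (H : functor C E) :
  naturally_isomorphic F F' -> naturally_isomorphic (functor_comp G F') H ->
  naturally_isomorphic (functor_comp G F) H.
Proof.
move=> [s [t [sn tn ts st]]] [s' [t' [s'n t'n ts' st']]].
exists (fun X => s' X \co fmap G (s X)), (fun X => fmap G (t X) \co t' X); split.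
- move=> X Y f /=.
  have nat1 : fmap G (s Y) \co fmap G (fmap F f) = fmap G (fmap F' f) \co fmap G (s X).
    by rewrite -!fmapM sn.
  have nat2 := s'n _ _ f.
  apply: etrans (esym (ccompA _ _ _)) _; rewrite nat1 ccompA [X in X \co _]nat2.
  exact/esym/ccompA.
- move=> X Y f /=.
  have nat1 : fmap G (t Y) \co fmap G (fmap F' f) = fmap G (fmap F f) \co fmap G (t X).
    by rewrite -!fmapM tn.
  have nat2 := t'n _ _ f.
  apply: etrans (esym (ccompA _ _ _)) _; rewrite nat2.
  apply: etrans (ccompA _ _ _) _.
  apply: etrans (_ : _ = fmap G (fmap F f) \co fmap G (t X) \co t' X) _.
    exact: (congr1 (fun z : chom (G (F' X)) (G (F Y)) => z \co t' X) nat1).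
  exact/esym/ccompA.
- move=> X; have tsX : fmap G (t X) \co fmap G (s X) = idm (G (F X)).
    by rewrite -fmapM ts fmap1.
  rewrite -ccompA (ccompA (t' X)) ts'.
  by apply: etrans tsX; congr (_ \co _); apply: ccomp1l.
- move=> X; have stX : fmap G (s X) \co fmap G (t X) = idm (G (F' X)).
    by rewrite -fmapM st fmap1.
  rewrite -ccompA -(st' X); congr (_ \co _).
  apply: etrans (ccompA _ _ _) _; rewrite stX.
  exact: ccomp1l.
Qed.

Lemma exact_completion_unique (C E E' : category) (J : functor C E)
    (J' : functor C E') :
  is_exact_completion J -> is_exact_completion J' ->
  exists (G : functor E E') (H : functor E' E),
    naturally_isomorphic (functor_comp H G) (functor_id E) /\
    naturally_isomorphic (functor_comp G H) (functor_id E').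
Proof.
move=> Jex J'ex.
case: (Jex) => _ Eex Jlex ext _; case: (J'ex) => _ E'ex J'lex ext' _.
have [G [Gr GJ]] := ext _ E'ex _ J'lex; have [H [Hr HJ]] := ext' _ Eex _ Jlex.
exists G, H; split.
  apply: (exact_completion_endo Jex); first exact: regular_functor_comp.
  exact: naturally_isomorphic_comp GJ HJ.
apply: (exact_completion_endo J'ex); first exact: regular_functor_comp.
exact: naturally_isomorphic_comp HJ GJ.
Qed.

(** * Cartesian closure is invariant under equivalence *)

Section ExponentialProducts.
Variables (C : category) (X Y Z P : C).
Variables (p1 : chom P Z) (p2 : chom P X) (ev : chom P Y).

Definition transposes W Q (q1 : chom Q W) (q2 : chom Q X) (f : chom Q Y)
    (g : chom W Z) :=
  exists h : chom Q P, [/\ p1 \co h = g \co q1, p2 \co h = q2 & ev \co h = f].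

(** Product cones over W and X being isomorphic, one of them for each W suffices. *)
Lemma exponential_of_chosen : is_product p1 p2 ->
  (forall W, exists Q (q1 : chom Q W) (q2 : chom Q X), is_product q1 q2 /\
     forall f, exists! g, transposes q1 q2 f g) ->
  is_exponential p1 p2 ev.
Proof.
move=> pP expP; split=> // W R r1 r2 rP f.
have [Q [q1 [q2 [qP ex]]]] := expP W.
have [u [[u1 u2] _]] := qP _ r1 r2.
have [v [[v1 v2] _]] := rP _ q1 q2.
have vu : v \co u = idm R.
  have [w [_ wP]] := rP _ r1 r2.
  apply: etrans (esym (wP _ _)) (wP _ _); last by rewrite !ccomp1r.
  by rewrite !ccompA v1 v2.
have [g [[h [h1 h2 h3]] gP]] := ex (f \co v).
exists g; split.
  exists (h \co u); split; rewrite ccompA ?h1 ?h2 ?h3 -?ccompA ?u1 ?vu ?ccomp1r //.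
move=> g' [h' [h'1 h'2 h'3]]; apply: gP; exists (h' \co v).
by split; rewrite ccompA ?h'1 ?h'2 ?h'3 // -ccompA v1.
Qed.

End ExponentialProducts.

Section Transport.
Variables (E E' : category) (G : functor E E').
Hypothesis Gfaithful : forall X Y (f g : chom X Y), fmap G f = fmap G g -> f = g.
Hypothesis Gfull : forall X Y (g : chom (G X) (G Y)), exists f, fmap G f = g.
Hypothesis Gess : forall Y', exists Y (i : chom (G Y) Y') (j : chom Y' (G Y)),
  i \co j = idm Y' /\ j \co i = idm (G Y).

Lemma reflect_terminal X : is_terminal (G X) -> is_terminal X.
Proof.
move=> GX Y; have [g [_ gP]] := GX (G Y); have [f fE] := Gfull g.
by exists f; split=> // f' _; apply: Gfaithful; rewrite fE (gP (fmap G f')).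
Qed.

Lemma reflect_product X Y P (p : chom P X) (q : chom P Y) :
  is_product (fmap G p) (fmap G q) -> is_product p q.
Proof.
move=> GP W u v; have [g [[g1 g2] gP]] := GP _ (fmap G u) (fmap G v).
have [h hE] := Gfull g; exists h; split.
  by split; apply: Gfaithful; rewrite fmapM hE.
move=> h' [h'1 h'2].
by apply: Gfaithful; rewrite hE; apply: gP; rewrite -!fmapM h'1 h'2.
Qed.

Hypothesis Eccc : cartesian_closed E'.

(** The product is lifted from E', so that it is known to be preserved by G. *)
Lemma transport_product X Y : exists P (p : chom P X) (q : chom P Y),
  is_product p q /\ is_product (fmap G p) (fmap G q).
Proof.
case: Eccc => _ prod _; have [P' [p' [q' P'P]]] := prod (G X) (G Y).
have [P [i [j [ij ji]]]] := Gess P'.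
have [p pE] := Gfull (p' \co i); have [q qE] := Gfull (q' \co i).
suff GP : is_product (fmap G p) (fmap G q).
  by exists P, p, q; split=> //; apply: reflect_product.
move=> W u v; have [h [[h1 h2] hP]] := P'P _ u v; exists (j \co h); split.
  by rewrite pE qE -!ccompA !(ccompA i) ij ccomp1l.
move=> h'; rewrite pE qE -!ccompA => /hP ->.
by rewrite ccompA ji ccomp1l.
Qed.

Lemma transport_cartesian_closed : cartesian_closed E.
Proof.
case: (Eccc) => [[T' T'P]] prod expo; split.
- have [T [i [j [ij ji]]]] := Gess T'; exists T; apply: reflect_terminal => W.
  have [w [_ wP]] := T'P W; exists (j \co w); split=> // v _.
  by rewrite (wP (i \co v)) // ccompA ji ccomp1l.
- move=> X Y; have [P [p [q [pq _]]]] := transport_product X Y.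
  by exists P, p, q.
move=> X Y; have [Z' [P' [p1' [p2' [ev' [P'P exP]]]]]] := expo (G X) (G Y).
have [Z [i [j [ij ji]]]] := Gess Z'.
have [P [p1 [p2 [PP GPP]]]] := transport_product Z X.
have [k [[k1 k2] _]] := P'P _ (i \co fmap G p1) (fmap G p2).
have [ev evE] := Gfull (ev' \co k).
exists Z, P, p1, p2, ev; apply: exponential_of_chosen => // W.
have [Q [q1 [q2 [QP GQP]]]] := transport_product W X.
exists Q, q1, q2; split=> // f.
have [g' [[h' [h'1 h'2 h'3]] gP]] := exP _ _ _ _ GQP (fmap G f).
have [g gE] := Gfull (j \co g').
exists g; split.
  have [h [[h1 h2] _]] := PP _ (g \co q1) q2; exists h; split=> //.
  apply: Gfaithful; rewrite fmapM evE -h'3 -ccompA; congr (_ \co _).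
  have [l [_ lP]] := P'P _ (g' \co fmap G q1) (fmap G q2).
  apply: etrans (esym (lP _ _)) (lP _ _); last by [].
  rewrite !ccompA k1 k2 -!ccompA -!fmapM.
  by rewrite h1 h2 fmapM gE !ccompA ij ccomp1l.
move=> g2 [h2 [h21 h22 h23]]; apply: Gfaithful; rewrite gE.
rewrite (gP (i \co fmap G g2)); first by rewrite ccompA ji ccomp1l.
exists (k \co fmap G h2); split.
- by rewrite ccompA k1 -!ccompA -!fmapM h21.
- by rewrite ccompA k2 -!fmapM h22.
- by rewrite ccompA -evE -fmapM h23.
Qed.

End Transport.

Lemma naturally_isomorphic_id_faithful (E E' : category) (G : functor E E')
    (H : functor E' E) X Y (f g : chom X Y) :
  naturally_isomorphic (functor_comp H G) (functor_id E) ->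
  fmap G f = fmap G g -> f = g.
Proof.
move=> [s [t [sn tn ts st]]] fg.
have E1 : f \co s X = g \co s X by have /= <- := sn _ _ f; have /= <- := sn _ _ g; rewrite fg.
have := congr1 (fun z => z \co t X) E1.
by rewrite -!ccompA !st !ccomp1r.
Qed.

Lemma equivalence_cartesian_closed (E E' : category) (G : functor E E')
    (H : functor E' E) :
  naturally_isomorphic (functor_comp H G) (functor_id E) ->
  naturally_isomorphic (functor_comp G H) (functor_id E') ->
  cartesian_closed E' -> cartesian_closed E.
Proof.
move=> HG GH; apply: (transport_cartesian_closed (G := G)).
- by move=> X Y f g; apply: naturally_isomorphic_id_faithful HG.
- move=> X Y g; case: (HG) => s [t [sn tn ts st]].
  exists (s Y \co fmap H g \co t X).
  apply: (naturally_isomorphic_id_faithful GH).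
  have := sn _ _ (s Y \co fmap H g \co t X) => /=.
  rewrite -!ccompA ts ccomp1r => E1.
  have := congr1 (fun z => t Y \co z) E1.
  by rewrite !ccompA ts !ccomp1l -!ccompA.
- move=> Y; case: GH => s [t [sn tn ts st]].
  by exists (H Y), (s Y), (t Y); split; [exact: st | exact: ts].
Qed.

(** * Cartesian closure of the exact completion *)

Section CartesianClosure.
Variables (C : category) (Clex : finitely_complete C) (bp : binary_products C).
Local Notation CX := (Cex C).
Local Notation "X ** Y" := (bprod bp X Y) (at level 40).

Local Notation pr1 := (@bfst C bp _ _).
Local Notation pr2 := (@bsnd C bp _ _).

Definition bmap (X W Z : C) (g : chom W Z) : chom (W ** X) (Z ** X) :=
  bpair bp (g \co bfst) bsnd.

Lemma bmap_comp X W Z Z' (g : chom Z Z') (f : chom W Z) :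
  bmap X (g \co f) = bmap X g \co bmap X f.
Proof. by rewrite /bmap bpair_comp -!ccompA bfst_pair bsnd_pair. Qed.

Lemma bmap_pair X W Z V (g : chom W Z) (w : chom V W) (x : chom V X) :
  bmap X g \co bpair bp w x = bpair bp (g \co w) x.
Proof. by rewrite /bmap bpair_comp -ccompA bfst_pair bsnd_pair. Qed.

Definition weak_exponentials := forall X Y : C,
  exists (Z : C) (ev : chom (Z ** X) Y),
    forall W (f : chom (W ** X) Y), exists g : chom W Z, ev \co bmap X g = f.

(** The part of P over which two morphisms out of P ** X agree for all x in X. *)
Definition universal_equalizers := forall (P X Z : C) (u v : chom (P ** X) Z),
  exists (Q : C) (m : chom Q P), u \co bmap X m = v \co bmap X m /\
    forall W (n : chom W P), u \co bmap X n = v \co bmap X n ->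
      exists k : chom W Q, m \co k = n.

Hypothesis wexp : weak_exponentials.
Hypothesis ueq : universal_equalizers.

(** Covered predicates are closed under universal quantification along product
projections: the witnesses, as x varies, form a point of a weak exponential,
and the universal equalizer cuts out those that lie over the right points. *)
Lemma covered_forall (P X : C) A : @covered C (P ** X) A ->
  covered (fun W (n : chom W P) => A (W ** X) (bmap X n)).
Proof.
move=> cA; case: (cA) => [E [r rP]]; have [Z [ev evP]] := wexp X E.
have [Q [m [mE mP]]] := ueq (r \co ev \co bmap X (bsnd (b := bp) (X := P))) (bmap X bfst).
exists Q, (bfst \co m) => W n; split.
  move=> /rP[l lE]; have [g gE] := evP _ l.
  have [|k kE] := mP _ (bpair bp n g).
    rewrite -(ccompA (r \co ev)) -!bmap_comp bfst_pair bsnd_pair.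
    by rewrite -ccompA gE.
  by exists k; rewrite -ccompA kE bfst_pair.
move=> [k <-]; rewrite bmap_comp; apply: (covered_stable cA).
apply/rP; rewrite bmap_comp -mE; exists (ev \co bmap X bsnd \co bmap X m).
by rewrite !ccompA.
Qed.

Definition exprod (X Y : exobj C) : exobj C :=
  ex_initial2 Clex bp (bfst (b := bp) (X := excar X) (Y := excar Y)) bsnd.
Definition exfst (X Y : exobj C) : chom (exprod X Y : CX) X :=
  cls (@ex_initial2_fst C Clex bp _ X Y bfst bsnd).
Definition exsnd (X Y : exobj C) : chom (exprod X Y : CX) Y :=
  cls (@ex_initial2_snd C Clex bp _ X Y bfst bsnd).

Lemma exprodP (X Y : exobj C) W (u v : chom W (excar X ** excar Y)) :
  erel (X := exprod X Y) u v <->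
  erel (X := X) (bfst \co u) (bfst \co v) /\ erel (X := Y) (bsnd \co u) (bsnd \co v).
Proof. exact: ex_initial2P. Qed.

Lemma exprod_is_product X Y : is_product (exfst X Y) (exsnd X Y).
Proof.
move=> W u v.
have c : compatible (X := W) (Y := exprod X Y) (bpair bp (rep u) (rep v)).
  by apply: compatible_initial2; rewrite ?bfst_pair ?bsnd_pair; apply: rep_compatible.
have hu : exfst X Y \co cls c = u.
  rewrite cls_comp; apply/(etrans _ (cls_rep u))/cls_eqP/erel_eq.
  exact: bfst_pair.
have hv : exsnd X Y \co cls c = v.
  rewrite cls_comp; apply/(etrans _ (cls_rep v))/cls_eqP/erel_eq.
  exact: bsnd_pair.
exists (cls c); split=> // h [h1 h2].
apply: (ex_initial2_monic (Clex := Clex) (f := bfst) (g := bsnd)).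
  exact: etrans hu (esym h1).
exact: etrans hv (esym h2).
Qed.

Section Exponential.
Variables X Y : exobj C.
Variables (Z : C) (ev0 : chom (Z ** excar X) (excar Y)).
Hypothesis ev0P : forall W (f : chom (W ** excar X) (excar Y)),
  exists g : chom W Z, ev0 \co bmap (excar X) g = f.

(* Q weakly represents the elements of the weak exponential that respect the
   relations. *)
Variables (Q : C) (m : chom Q Z).
Hypothesis mP : forall W (n : chom W Z),
  erel (X := Y) (ev0 \co bpair bp (n \co pr1) (ex1 X \co pr2))
                (ev0 \co bpair bp (n \co pr1) (ex2 X \co pr2)) <->
  exists k : chom W Q, m \co k = n.

Let ev := ev0 \co bmap (excar X) m.

Definition exp_rel W (w w' : chom W Q) :=
  erel (X := Y) (ev \co bmap (excar X) w) (ev \co bmap (excar X) w').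

Lemma exp_rel_equivalence : stagewise_equivalence exp_rel.
Proof.
split=> W; first by move=> w; apply: erel_refl.
  by move=> w w'; apply: erel_sym.
by move=> w w' w''; apply: erel_trans.
Qed.

Lemma exp_rel_covered :
  covered (fun W (p : chom W (Q ** Q)) => exp_rel (bfst \co p) (bsnd \co p)).
Proof.
have /covered_forall := covered_erel Clex bp (Y := Y)
  (ev \co bmap (excar X) (bfst (b := bp) (X := Q) (Y := Q))) (ev \co bmap (excar X) bsnd).
by apply: eq_covered => W p; rewrite /exp_rel !bmap_comp !ccompA.
Qed.

Definition exp_obj : exobj C := build_exobj exp_rel_covered exp_rel_equivalence.

Lemma exp_objP W (w w' : chom W Q) : erel (X := exp_obj) w w' <-> exp_rel w w'.
Proof. exact: build_erelP. Qed.

(** Evaluation respects the relation in the function by definition of that relation,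
and the relation in the argument by the choice of Q. *)
Lemma ev_compatible : compatible (X := exprod exp_obj X) (Y := Y) ev.
Proof.
move=> V p p' /exprodP[/exp_objP]; change (chom V (Q ** excar X)) in p, p'.
move=> ww' [rho [rho1 rho2]]; change (exp_rel (pr1 \co p) (pr1 \co p')) in ww'.
change (ex1 X \co rho = pr2 \co p) in rho1.
change (ex2 X \co rho = pr2 \co p') in rho2.
apply: erel_trans (_ : erel (ev \co bpair bp (bfst \co p') (bsnd \co p)) _).
  have := erel_comp (bpair bp (idm V) (bsnd \co p)) ww'.
  by rewrite -!(ccompA ev) !bmap_pair !ccomp1r bpair_eta.
have evE (i : chom (exrel X) (excar X)) :
    ev0 \co bpair bp (m \co pr1) (i \co pr2) \co bpair bp (pr1 \co p') rho =
    ev \co bpair bp (pr1 \co p') (i \co rho).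
  by rewrite /ev -!ccompA bpair_comp -!ccompA bfst_pair bsnd_pair bmap_pair.
have /mP/(erel_comp (bpair bp (pr1 \co p') rho)) : exists k, m \co k = m.
  by exists (idm Q); rewrite ccomp1r.
by rewrite !evE rho1 rho2 (bpair_eta p').
Qed.

Definition exev : chom (exprod exp_obj X : CX) Y := cls ev_compatible.

Lemma Cex_exponential : exists (E P : CX) (p1 : chom P E) (p2 : chom P X)
  (e : chom P Y), is_exponential p1 p2 e.
Proof.
exists exp_obj, (exprod exp_obj X), (exfst exp_obj X), (exsnd exp_obj X), exev.
apply: exponential_of_chosen; first exact: exprod_is_product.
move=> W; exists (exprod W X), (exfst W X), (exsnd W X).
split=> [|f]; first exact: exprod_is_product.
have [g0 g0E] := ev0P (rep f).
have fc V (w w' : chom V (excar W)) (x x' : chom V (excar X)) :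
    erel w w' -> erel x x' ->
    erel (X := Y) (rep f \co bpair bp w x) (rep f \co bpair bp w' x').
  move=> ww' xx'; apply: rep_compatible; apply/exprodP.
  by rewrite !bfst_pair !bsnd_pair.
have [k kE] : exists k : chom (excar W) Q, m \co k = g0.
  apply/mP; rewrite -!bmap_pair !ccompA g0E; apply: fc; first exact: erel_refl.
  exact/erel_comp/erel_gen.
have evk : ev \co bmap (excar X) k = rep f by rewrite /ev -ccompA -bmap_comp kE.
have kc : compatible (X := W) (Y := exp_obj) k.
  move=> V w w' ww'; apply/exp_objP.
  rewrite /exp_rel !bmap_comp !ccompA evk; apply: fc; last exact: erel_refl.
  exact: erel_comp.
have bk : compatible (X := exprod W X) (Y := exprod exp_obj X) (bmap (excar X) k).
  apply: compatible_initial2; rewrite ?bfst_pair ?bsnd_pair.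
    by apply: compatible_comp => //; apply: ex_initial2_fst.
  exact: ex_initial2_snd.
exists (cls kc); split.
  exists (cls bk); split; rewrite cls_comp.
  - by rewrite cls_comp; apply/cls_eqP/erel_eq; rewrite bfst_pair.
  - by apply/cls_eqP/erel_eq; rewrite bsnd_pair.
  - by apply/(etrans _ (cls_rep f))/cls_eqP/erel_eq.
move=> g' [h' []]; rewrite -(cls_rep g') -(cls_rep h') !cls_comp.
move=> /cls_eqP h'1 /cls_eqP h'2; rewrite -{1}(cls_rep f) => /cls_eqP h'3.
apply/cls_eqP/exp_objP; rewrite /exp_rel evk.
apply: erel_trans (erel_sym h'3) _; apply: ev_compatible.
by apply/exprodP; rewrite bfst_pair bsnd_pair.
Qed.

End Exponential.

Theorem Cex_cartesian_closed : cartesian_closed CX.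
Proof.
split.
- by case: (Cex_finitely_complete Clex bp).
- by move=> X Y; exists (exprod X Y), (exfst X Y), (exsnd X Y); apply: exprod_is_product.
move=> X Y; have [Z [ev0 ev0P]] := wexp (excar X) (excar Y).
have /covered_forall[Q [m mP]] := covered_erel Clex bp (Y := Y)
  (ev0 \co bpair bp pr1 (ex1 X \co pr2)) (ev0 \co bpair bp pr1 (ex2 X \co pr2)).
have mP' W (n : chom W Z) :
  erel (X := Y) (ev0 \co bpair bp (n \co pr1) (ex1 X \co pr2))
                (ev0 \co bpair bp (n \co pr1) (ex2 X \co pr2)) <->
  exists k : chom W Q, m \co k = n.
  by rewrite -mP -!ccompA !bpair_comp -!ccompA /bmap !bfst_pair !bsnd_pair.
exact (Cex_exponential ev0P mP').
Qed.

End CartesianClosure.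

(** Being an exact completion determines E up to equivalence, so cartesian closure
may be checked on the explicit construction. *)
Theorem exact_completion_cartesian_closed (C : category) (bp : binary_products C) :
  finitely_complete C -> weak_exponentials bp -> universal_equalizers bp ->
  forall (E : category) (J : functor C E), is_exact_completion J ->
  cartesian_closed E.
Proof.
move=> Clex wexp ueq E J Jex.
have [G [H [HG GH]]] := exact_completion_unique Jex (Cex_exact_completion Clex).
exact: equivalence_cartesian_closed HG GH (Cex_cartesian_closed Clex wexp ueq).
Qed.

(** * Calculus of V-relations *)

Section TV.
Local Open Scope type_scope.
Variables (d : Order.disp_t) (V : tbLatticeType d) (K : quantale V).
Local Notation tens := (qtens K).
Local Notation sup := (qsup K).
Local Notation k := (qunit K).
Local Notation "x <=V y" := (x <= y :> V)%O (at level 70).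

Lemma sup_ub (A : set V) x : A x -> x <=V sup A.
Proof. by case: (qsupP K A) => ub _ /ub. Qed.

Lemma sup_le (A : set V) y : (forall x, A x -> x <=V y) -> sup A <=V y.
Proof. by case: (qsupP K A) => _ lub Ay; apply: lub. Qed.

Lemma tens_ler u v w : v <=V w -> tens u v <=V tens u w.
Proof. by move=> vw; rewrite qhomP; apply: le_trans vw _; rewrite -qhomP. Qed.

Lemma tens_le u u' v v' : u <=V u' -> v <=V v' -> tens u v <=V tens u' v'.
Proof.
move=> uu' vv'; apply: (le_trans (tens_ler _ vv')).
by rewrite !(qtensC _ _ v'); apply: tens_ler.
Qed.

Lemma tens1r u : tens u k = u.
Proof. by rewrite qtensC qtens1. Qed.

Lemma tens_sup_le u A w : (forall v, A v -> tens u v <=V w) -> tens u (sup A) <=V w.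
Proof. by move=> H; rewrite qhomP; apply: sup_le => v Av; rewrite -qhomP; apply: H. Qed.

Lemma sup_tens_le u A w : (forall v, A v -> tens v u <=V w) -> tens (sup A) u <=V w.
Proof.
by move=> H; rewrite qtensC; apply: tens_sup_le => v Av; rewrite qtensC; apply: H.
Qed.

Hypothesis V_heyting : heyting_algebra V.

Lemma meet_sup_le u A w :
  (forall v, A v -> (u `&` v)%O <=V w) -> (u `&` sup A)%O <=V w.
Proof.
move=> H; have [imp impP] := V_heyting u.
by rewrite impP; apply: sup_le => v Av; rewrite -impP; apply: H.
Qed.

Variables (T : monad) (T_wpb : preserves_weak_pullbacks T).
Variables (m_wpb : mult_weakly_cartesian T).
Variables (xi : T V -> V) (xi_theory : strict_topological_theory K xi).
Local Notation Tm := (mmap T).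
Local Notation mu := (mmult T).
Local Notation eta := (munit T).

Lemma mmap_eta_pt (X Y : Type) (f : X -> Y) (y : Y) (t : T X) :
  (forall x, f x = y) -> Tm f t = Tm (fun _ : unit => y) (Tm (fun=> tt) t).
Proof. by move=> fy; rewrite -mmapM; congr (Tm _ t); apply: funext. Qed.

Lemma lift_pullback (X Y Z : Type) (f : X -> Z) (g : Y -> Z) (x : T X) (y : T Y) :
  Tm f x = Tm g y ->
  exists w : T {p : X * Y | f p.1 = g p.2},
    Tm (fun p => (sval p).1) w = x /\ Tm (fun p => (sval p).2) w = y.
Proof.
move=> fg.
have wpb : weak_pullback f g (fun p : {p : X * Y | f p.1 = g p.2} => (sval p).1)
    (fun p => (sval p).2).
  split=> [[] // | W u v uv].
  by exists (fun w => exist _ (u w, v w) (uv w)).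
have [_ /(_ unit (fun=> x) (fun=> y) (fun=> fg))[h [hx hy]]] := T_wpb wpb.
by exists (h tt).
Qed.

Lemma lift_fst (X Y Z : Type) (f : X -> Z) (q : T (Z * Y)) (x : T X) :
  Tm fst q = Tm f x ->
  exists r : T (X * Y), Tm fst r = x /\ Tm (fun p => (f p.1, p.2)) r = q.
Proof.
move=> /lift_pullback[w [wq wx]].
exists (Tm (fun p => ((sval p).2, (sval p).1.2)) w); rewrite -!mmapM; split=> //.
rewrite -[RHS]wq; congr (Tm _ w); apply: funext => -[[[z y] x'] /= ->].
by [].
Qed.

(** T 1 may have many points: what lies over a pure point z of Z is an element of T Y
over the pure point of 1, not an arbitrary one. *)
Lemma lift_fst_eta (Y Z : Type) (q : T (Z * Y)) (z : Z) :
  Tm fst q = eta z ->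
  exists y : T Y, Tm (fun=> tt) y = eta tt /\ Tm (fun y => (z, y)) y = q.
Proof.
rewrite -(munit_nat T (fun _ : unit => z) tt) => /lift_fst[r [r1 r2]].
exists (Tm snd r); rewrite -!mmapM; split=> //.
by rewrite -r1; congr (Tm _ r); apply: funext; case=> -[].
Qed.

Lemma lift_mult (X Y : Type) (f : X -> Y) (x : T X) (y : T (T Y)) :
  Tm f x = mu y -> exists w : T (T X), mu w = x /\ Tm (Tm f) w = y.
Proof.
move=> fxy.
have [_ /(_ unit (fun=> x) (fun=> y) (fun=> fxy))[h [hx hy]]] := m_wpb f.
by exists (h tt).
Qed.

Lemma xi_eta v : xi (eta v) = v.
Proof. by case: (theory_EM xi_theory) => + _; apply. Qed.

Lemma xi_mono (X : Type) (phi psi : X -> V) (t : T X) :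
  (forall x, phi x <=V psi x) -> xi (Tm phi t) <=V xi (Tm psi t).
Proof. by move=> h; apply: (theory_mono xi_theory). Qed.

Lemma xi_mult (X : Type) (phi : X -> V) (t : T (T X)) :
  xi (Tm (fun s => xi (Tm phi s)) t) = xi (Tm phi (mu t)).
Proof.
case: (theory_EM xi_theory) => _ EM.
by rewrite mmult_nat EM -mmapM.
Qed.

Lemma xi_tens (X : Type) (phi psi : X -> V) (t : T X) :
  xi (Tm (fun x => tens (phi x) (psi x)) t) = tens (xi (Tm phi t)) (xi (Tm psi t)).
Proof.
have := theory_tens xi_theory (Tm (fun x => (phi x, psi x)) t).
by rewrite -!mmapM.
Qed.

(** Naturality of xi with respect to direct images, in the form in which suprema in V
are moved out of xi. *)
Lemma xi_image_le (X Y : Type) (f : X -> Y) (phi : X -> V) (t : T Y) z :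
  (forall s, Tm f s = t -> xi (Tm phi s) <=V z) ->
  xi (Tm (vdirect_image K f phi) t) <=V z.
Proof.
move=> H; rewrite (theory_nat xi_theory); apply: sup_le => _ [s /= fs <-].
exact: H.
Qed.

Local Notation ext := (vext K xi).

(** The only way in which lower bounds on ext r are obtained: the pair f, g carries t
to an element of T (X * Y) that witnesses the supremum. *)
Lemma ext_ub (X Y Z : Type) (r : vrel V X Y) (f : Z -> X) (g : Z -> Y) (phi : Z -> V)
    (t : T Z) :
  (forall z, phi z <=V r (f z) (g z)) -> xi (Tm phi t) <=V ext r (Tm f t) (Tm g t).
Proof.
move=> H; apply: (le_trans (xi_mono _ H)).
apply: sup_ub; exists (Tm (fun z => (f z, g z)) t); last by rewrite -mmapM.
by rewrite /= -!mmapM.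
Qed.

Lemma ext_le (X Y : Type) (r : vrel V X Y) (x : T X) (y : T Y) z :
  (forall w, Tm fst w = x -> Tm snd w = y ->
     xi (Tm (fun p => r p.1 p.2) w) <=V z) ->
  ext r x y <=V z.
Proof. by move=> H; apply: sup_le => _ [w [wx wy] <-]; apply: H. Qed.

Lemma ext_map (X Y X' Y' : Type) (r : vrel V X Y) (r' : vrel V X' Y')
    (f : X -> X') (g : Y -> Y') (x : T X) (y : T Y) :
  (forall x y, r x y <=V r' (f x) (g y)) -> ext r x y <=V ext r' (Tm f x) (Tm g y).
Proof.
move=> H; apply: ext_le => w <- <-; rewrite -!mmapM.
exact: ext_ub.
Qed.

(** * Limits of (T,V)-categories *)

Local Notation TVobj := (TVobj K xi).
Local Notation TVhom := (@TVhom d V K T xi).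

Section Structure.
Variables (X : Type) (a : vrel V (T X) X) (aP : TV_category K xi a).

Lemma TV_refl x : k <=V a (eta x) x.
Proof. by case: aP. Qed.

Lemma TV_trans (tt : T (T X)) t x : tens (ext a tt t) (a t x) <=V a (mu tt) x.
Proof. by case: aP. Qed.

End Structure.

Lemma initial_category (X Y : Type) (f : X -> Y) (b : vrel V (T Y) Y) :
  TV_category K xi b -> TV_category K xi (fun t x => b (Tm f t) (f x)).
Proof.
move=> bP; split=> [x | tt t x]; first by rewrite munit_nat TV_refl.
rewrite mmult_nat; apply: le_trans (TV_trans bP _ (Tm f t) (f x)).
by apply: tens_le => //; apply: ext_map.
Qed.

Lemma meet_category (X : Type) (a b : vrel V (T X) X) :
  TV_category K xi a -> TV_category K xi b ->
  TV_category K xi (fun t x => a t x `&` b t x)%O.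
Proof.
move=> aP bP; split=> [x | tt t x]; rewrite lexI; first by rewrite !TV_refl.
have le1 : forall t x, (a t x `&` b t x)%O <=V a t x by move=> *; apply: leIl.
have le2 : forall t x, (a t x `&` b t x)%O <=V b t x by move=> *; apply: leIr.
have E (X' : Type) (y : T X') : Tm id y = y by exact: mmap1.
apply/andP; split.
  apply: le_trans (TV_trans aP _ t x); apply: tens_le => //.
  by rewrite -{2}(E _ tt) -{2}(E _ t); apply: ext_map.
apply: le_trans (TV_trans bP _ t x); apply: tens_le => //.
by rewrite -{2}(E _ tt) -{2}(E _ t); apply: ext_map.
Qed.

Definition TVinitial (X : Type) (Y : TVobj) (f : X -> Y) : TVobj :=
  TVObj (initial_category f (TVstrP Y)).

Definition TVprod (X Y : TVobj) : TVobj :=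
  TVObj (meet_category
    (initial_category (@fst X Y) (TVstrP X))
    (initial_category (@snd X Y) (TVstrP Y))).

Lemma TVfst_subproof (X Y : TVobj) :
  TV_functor (TVstr (t := (TVprod X Y))) (TVstr (t := X)) (@fst X Y).
Proof. by move=> t x; apply: leIl. Qed.
Definition TVfst (X Y : TVobj) : TVhom (TVprod X Y) X := TVHom (@TVfst_subproof X Y).

Lemma TVsnd_subproof (X Y : TVobj) :
  TV_functor (TVstr (t := (TVprod X Y))) (TVstr (t := Y)) (@snd X Y).
Proof. by move=> t x; apply: leIr. Qed.
Definition TVsnd (X Y : TVobj) : TVhom (TVprod X Y) Y := TVHom (@TVsnd_subproof X Y).

Lemma TVpair_subproof (W X Y : TVobj) (f : TVhom W X) (g : TVhom W Y) :
  TV_functor (TVstr (t := W)) (TVstr (t := (TVprod X Y)))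
    (fun w => (f w, g w)).
Proof.
move=> t x /=; rewrite -!mmapM lexI; apply/andP; split; exact: TVfunP.
Qed.
Definition TVpair (W X Y : TVobj) (f : TVhom W X) (g : TVhom W Y) :
  TVhom W (TVprod X Y) := TVHom (TVpair_subproof f g).

Lemma TVhom_ext (X Y : TVobj) (f g : TVhom X Y) : f =1 g -> f = g.
Proof. by move=> fg; apply: TVhom_eq; apply: funext. Qed.

Lemma TVhom_app (X Y : TVobj) (f g : TVhom X Y) x : f = g -> f x = g x.
Proof. by move=> ->. Qed.

Definition TVproducts : binary_products (TVCat K xi).
Proof.
refine (@BinaryProducts (TVCat K xi) TVprod TVfst TVsnd TVpair _ _ _).
- by move=> W X Y u v; apply: TVhom_ext.
- by move=> W X Y u v; apply: TVhom_ext.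
- move=> X Y W u v uv1 uv2; apply: TVhom_ext => w.
  have := TVhom_app w uv1; have := TVhom_app w uv2 => /=.
  by case: (TVfun u w) (TVfun v w) => [? ?] [? ?] /= -> ->.
Defined.

Lemma TVinitial_in_subproof (X : Type) (Y : TVobj) (f : X -> Y) :
  TV_functor (TVstr (t := (TVinitial f))) (TVstr (t := Y)) f.
Proof. by []. Qed.
Definition TVinitial_in (X : Type) (Y : TVobj) (f : X -> Y) : TVhom (TVinitial f) Y :=
  TVHom (@TVinitial_in_subproof X Y f).

Lemma TVinitial_lift (X : Type) (Y W : TVobj) (f : X -> Y) (g : W -> X)
    (h : TVhom W Y) :
  (forall w, f (g w) = h w) ->
  TV_functor (TVstr (t := W)) (TVstr (t := (TVinitial f))) g.
Proof.
move=> fg t x /=; rewrite -mmapM.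
by rewrite (_ : (fun z => f (g z)) = h) ?fg; [apply: TVfunP | apply: funext].
Qed.

Lemma TVCat_finitely_complete : finitely_complete (TVCat K xi).
Proof.
split.
  have top_cat : TV_category K xi (fun (_ : T unit) (_ : unit) => \top%O).
    by split=> *; apply: lex1.
  pose one : TVobj := TVObj top_cat; exists one => Y.
  have fP : TV_functor (TVstr (t := Y)) (TVstr (t := one)) (fun=> tt).
    by move=> *; apply: lex1.
  exists (TVHom fP : TVhom Y one); split=> // g _.
  by apply: TVhom_ext => y; case: (g y).
move=> X Y Z f g.
pose S := {p : X * Y | f p.1 = g p.2}.
pose i (s : S) : TVprod X Y := sval s.
pose P := TVinitial i.
exists P, (TVcomp (TVfst X Y) (TVinitial_in i)), (TVcomp (TVsnd X Y) (TVinitial_in i)).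
split; first by apply: TVhom_ext => -[p pP].
move=> W u v uv.
have uvP w : f (u w) = g (v w) by have := TVhom_app w uv.
pose h w : S := exist _ (u w, v w) (uvP w).
have hP : TV_functor (TVstr (t := W)) (TVstr (t := P)) h.
  exact: (@TVinitial_lift S (TVprod X Y) W i h (TVpair u v)).
exists (TVHom hP : TVhom W P); split.
  by split; apply: TVhom_ext.
move=> h' [h'1 h'2]; apply: TVhom_ext => w.
have := TVhom_app w h'1; have := TVhom_app w h'2; rewrite /= /i /h.
case: (TVfun h' w) => -[x y] /= xyP ey ex; move: (uvP w); rewrite -ex -ey => xyP'.
by congr exist; apply: Prop_irrelevance.
Qed.

Lemma TVCat_universal_equalizers : universal_equalizers TVproducts.
Proof.
move=> P X Z u v.
pose S := {p : P | forall x : X, u (p, x) = v (p, x)}.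
pose i (s : S) : P := sval s.
exists (TVinitial i), (TVinitial_in i); split.
  by apply: TVhom_ext => -[[p pP] x]; apply: pP.
move=> W n uv.
have nP w x : u (n w, x) = v (n w, x) by apply: (@TVhom_app (TVprod W X) _ _ _ (w, x) uv).
pose h w : S := exist _ (n w) (nP w).
have hP : TV_functor (TVstr (t := W)) (TVstr (t := (TVinitial i))) h.
  exact: (@TVinitial_lift S P W i h n).
by exists (TVHom hP : TVhom W (TVinitial i)); apply: TVhom_ext.
Qed.


(** * Presheaf objects *)

Hypothesis ext_scale : forall (X Y : Type) (a : vrel V X Y) (u : V),
  ext (vscale K a u) = vscale K (ext a) u.

(** For u = k this is an axiom of topological theories; scaling the constant relation
k on the one-point set by u yields the other values. *)
Lemma xi_const (X : Type) (u : V) (t : T X) : xi (Tm (fun=> u) t) = u.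
Proof.
suff E (w : T unit) : xi (Tm (fun=> u) w) = u.
  by rewrite -[RHS](E (Tm (fun=> tt) t)) -mmapM.
have extC v : ext (fun _ _ : unit => v) w w = xi (Tm (fun=> v) w).
  apply/le_anti/andP; split; last first.
    by rewrite -{2 3}(mmap1 w); apply: ext_ub.
  apply: ext_le => p pw _; rewrite -pw -mmapM.
  by apply: xi_mono.
have scaleE : vscale K (fun _ _ : unit => k) u = (fun _ _ => u).
  by apply: funext => ?; apply: funext => ?; apply: qtens1.
have := congr1 (fun r => r w w) (ext_scale (fun _ _ : unit => k) u).
by rewrite scaleE /vscale !extC (theory_unit xi_theory) qtens1.
Qed.

Section Presheaf.
Variable S : Type.

(** The presheaves on a (T,V)-category with underlying set S: the points of the
exponential, for the tensor product, of V by the discrete (T,V)-category given by the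
free algebra T S. The condition on h says that h is a functor out of it, its elements
z being restricted to those over the pure point of T 1. *)
Definition presheaf := {h : T S -> V |
  forall z : T (T S), Tm (fun=> tt) z = eta tt -> xi (Tm h z) <=V h (mu z)}.

Implicit Types (h : presheaf) (p : T presheaf) (q : T (presheaf * T S)).

Definition evalP q : V := xi (Tm (fun c : presheaf * T S => sval c.1 c.2) q).

(** The largest structure for which evaluation is a functor of two variables. *)
Definition presheaf_str : vrel V (T presheaf) presheaf := fun p h =>
  sup [set v | forall q, Tm fst q = p -> tens v (evalP q) <=V sval h (mu (Tm snd q))].

Lemma presheaf_strP v p h : v <=V presheaf_str p h <->
  forall q, Tm fst q = p -> tens v (evalP q) <=V sval h (mu (Tm snd q)).
Proof.
split=> [vph q qp | H]; last exact: sup_ub.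
apply: (le_trans (tens_le vph (lexx _))).
by apply: sup_tens_le => w; apply.
Qed.

Lemma presheaf_str_eval q h :
  tens (presheaf_str (Tm fst q) h) (evalP q) <=V sval h (mu (Tm snd q)).
Proof. by apply: (presheaf_strP _ _ _).1. Qed.

(** For transitivity, q lies over mu PP, so weak cartesianness of the multiplication
yields Q over PP with mu Q = q; a witness w relating PP to p carries Q to an element
over p, to which the structure at p and h applies. *)
Lemma presheaf_category : TV_category K xi presheaf_str.
Proof.
split=> [h | PP p h].
  apply/presheaf_strP => q; rewrite qtens1 => qh.
  have [z [zpt zq]] := lift_fst_eta qh; rewrite -zq.
  by rewrite /evalP -!mmapM mmap1; apply: (svalP h).
apply/presheaf_strP => q /lift_mult[Q [<- QP]].
rewrite -qtensA; apply: sup_tens_le => _ [w [w1 w2] <-].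
(* Pair the elements of Q with those of w having the same first component. *)
have [r [r1 r2]] : exists r : T (T (presheaf * T S) * presheaf),
    Tm fst r = Q /\ Tm (fun c => (Tm fst c.1, c.2)) r = w.
  by apply: lift_fst; rewrite w1.
pose f (c : T (presheaf * T S) * presheaf) := (c.2, mu (Tm snd c.1)).
have fw : Tm fst (Tm f r) = p.
  by rewrite -mmapM -w2 -r2 -mmapM.
have fz : mu (Tm snd (Tm f r)) = mu (Tm snd (mu Q)).
  rewrite -mmapM (mmapM (@mmult T S) (fun c => Tm snd c.1)) -mmultA.
  by rewrite (mmapM (Tm snd) fst) r1 mmult_nat.
have fe : tens (xi (Tm (fun c => presheaf_str c.1 c.2) w)) (evalP (mu Q))
    <=V evalP (Tm f r).
  rewrite /evalP -xi_mult -r1 -r2 -!mmapM -xi_tens; apply: xi_mono => -[q' h'] /=.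
  exact: presheaf_str_eval.
have le1 : tens (presheaf_str p h) (evalP (Tm f r)) <=V sval h (mu (Tm snd (mu Q))).
  by rewrite -fz -fw; apply: presheaf_str_eval.
apply: le_trans le1; rewrite qtensA [X in tens X _ <=V _]qtensC -qtensA.
exact: tens_le.
Qed.


Definition presheaf_obj : TVobj := TVObj presheaf_category.

(** Maps into presheaves from functors of two variables. The case of a constant family
in B shows that each F b is a presheaf. *)
Lemma presheaf_transpose (B : TVobj) (F : B -> T S -> V) :
  (forall (r : T (B * T S)) (b : B),
     tens (xi (Tm (fun c => F c.1 c.2) r)) (TVstr (Tm fst r) b)
     <=V F b (mu (Tm snd r))) ->
  exists f : TVhom B presheaf_obj, forall b z, sval (f b) z = F b z.
Proof.
move=> HF.
have Fp b (z : T (T S)) : Tm (fun=> tt) z = eta tt -> xi (Tm (F b) z) <=V F b (mu z).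
  move=> zpt; have := HF (Tm (fun s => (b, s)) z) b; rewrite -!mmapM mmap1.
  apply: le_trans; rewrite -[X in X <=V _]tens1r; apply: tens_le => //.
  rewrite (mmap_eta_pt (y := b)) // zpt munit_nat; exact: (TV_refl (TVstrP B)).
pose f b : presheaf := exist _ (F b) (Fp b).
have fP : TV_functor (TVstr (t := B)) (TVstr (t := presheaf_obj)) f.
  move=> t b; apply/presheaf_strP => q /lift_fst[r [<- <-]].
  by rewrite qtensC /evalP -!mmapM; apply: HF.
by exists (TVHom fP).
Qed.

Lemma presheaf_eval (B : TVobj) (f : TVhom B presheaf_obj) (r : T (B * T S)) (b : B) :
  tens (xi (Tm (fun c => sval (f c.1) c.2) r)) (TVstr (Tm fst r) b)
  <=V sval (f b) (mu (Tm snd r)).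
Proof.
have := presheaf_str_eval (Tm (fun c => (f c.1, c.2)) r) (f b).
rewrite /evalP -!mmapM; apply: le_trans; rewrite qtensC; apply: tens_le => //.
rewrite (mmapM f fst); exact: (TVfunP f).
Qed.

(** Presheaf objects are injective with respect to fully faithful functors; the
extension is a left Kan extension. *)
Lemma presheaf_injective (A B : TVobj) (i : TVhom A B) (f : TVhom A presheaf_obj) :
  (forall t a, TVstr (Tm i t) (i a) <=V TVstr t a) ->
  exists g : TVhom B presheaf_obj, forall a, g (i a) = f a.
Proof.
move=> iff.
pose phi (w : T (A * T S)) := xi (Tm (fun c => sval (f c.1) c.2) w).
pose Psi (c : T (A * T S) * B) := tens (phi c.1) (TVstr (Tm i (Tm fst c.1)) c.2).
pose j (c : T (A * T S) * B) := (c.2, mu (Tm snd c.1)).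
pose F b z := vdirect_image K j Psi (b, z).
have [r b | g gE] := @presheaf_transpose B F.
  rewrite qtensC; rewrite (_ : (fun c => _) = vdirect_image K j Psi); last first.
    by apply: funext => -[].
  rewrite qhomP; apply: xi_image_le => R jR; rewrite -qhomP qtensC.
  have R2 : Tm fst r = Tm snd R by rewrite -jR -mmapM.
  have Rz : mu (Tm snd (mu (Tm fst R))) = mu (Tm snd r).
    rewrite -jR -mmapM (mmapM (@mmult T S) (fun c => Tm snd c.1)) -mmultA.
    by rewrite (mmapM (Tm snd) fst) mmult_nat.
  rewrite /Psi xi_tens.
  apply: (@le_trans _ _ (Psi (mu (Tm fst R), b))); last first.
    by apply: sup_ub; exists (mu (Tm fst R), b) => //; rewrite /j /= Rz.
  rewrite -qtensA /Psi; apply: tens_le.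
    by rewrite /= /phi -xi_mult -mmapM.
  rewrite /= mmult_nat mmult_nat; apply: le_trans (TV_trans (TVstrP B) _ (Tm fst r) b).
  apply: tens_le => //; rewrite R2 -!mmapM.
  exact: (ext_ub (f := fun c => Tm i (Tm fst c.1)) (g := snd)).
exists g => a.
have E z : sval (g (i a)) z = sval (f a) z.
  rewrite gE; apply/le_anti/andP; split.
    apply: sup_le => _ [[w b] /= [-> <-] <-]; rewrite /Psi /=.
    apply: le_trans (presheaf_eval f w a); apply: tens_le => //.
  rewrite -[X in X <=V _]tens1r; apply: (@le_trans _ _ (Psi (eta (a, z), i a))).
    rewrite /Psi /phi /= !munit_nat xi_eta; apply: tens_le => //.
    exact: (TV_refl (TVstrP B)).
  by apply: sup_ub; exists (eta (a, z), i a) => //; rewrite /j /= munit_nat mmult_unitl.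
case: (g (i a)) (f a) E => [h hP] [h' h'P] /= E.
have hh' : h = h' by apply: funext.
by case: _ / hh' in h'P E *; congr exist; apply: Prop_irrelevance.
Qed.

End Presheaf.

(** The Yoneda functor sends x to the presheaf with value TVstr z x at z. It is fully
faithful by evaluating the family of representables at the corresponding units. *)
Lemma yoneda_exists (X : TVobj) : exists y : TVhom X (presheaf_obj X),
  forall t x, TVstr (Tm y t) (y x) <=V TVstr t x.
Proof.
have [r x | y yE] := @presheaf_transpose X X (fun x z => TVstr z x).
  apply: le_trans (TV_trans (TVstrP X) _ (Tm fst r) x); apply: tens_le => //.
  exact: (ext_ub (f := snd) (g := fst)).
exists y => t x.
have := presheaf_str_eval (Tm (fun x => (y x, eta x)) t) (y x).
rewrite -!mmapM mmult_unitr yE; apply: le_trans.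
rewrite -[X in X <=V _]tens1r; apply: tens_le => //.
rewrite /evalP -mmapM -[X in X <=V _](xi_const k t); apply: xi_mono => x' /=.
rewrite yE; exact: (TV_refl (TVstrP X)).
Qed.

(** * Exponentiability *)

Hypothesis meet_tens : forall u v w : V,
  (w `&` tens u v)%O
  = sup [set z | exists u' v' : V,
           [/\ (u' <= u)%O, (v' <= v)%O, (tens u' v' <= w)%O & z = tens u' v']].

(** A convergence of degree tens u v through a multiplication splits, up to suprema,
into convergences of degrees u and v. *)
Definition decomposable (X : TVobj) := forall (tt : T (T X)) (x : X) (u v : V),
  (TVstr (mu tt) x `&` tens u v)%O <=V
  sup [set (tens (ext (TVstr (t := X)) tt t `&` u) (TVstr t x `&` v))%O
      | t in [set: T X]].

Section Decomposable.
Variable S : Type.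
Local Notation P := (presheaf S).

(** At (p, z), the value at z of the colimit of the family of presheaves p, tensored
with u. *)
Definition tcolim (u : V) (c : T P * T S) : V :=
  vdirect_image K (fun q : T (P * T S) => (Tm fst q, mu (Tm snd q)))
    (fun q => tens (evalP q) u) c.

Lemma tcolim_le u (Q : T (T P * T S)) z :
  (forall q : T (P * T S), Tm fst q = mu (Tm fst Q) ->
     mu (Tm snd q) = mu (Tm snd Q) -> tens (evalP q) u <=V z) ->
  xi (Tm (tcolim u) Q) <=V z.
Proof.
move=> H; apply: xi_image_le => R RQ.
rewrite xi_tens xi_const /evalP xi_mult; apply: H.
  by rewrite -RQ -mmapM mmult_nat.
rewrite -RQ -mmapM (mmapM (@mmult T S) (Tm snd)) -mmultA.
by rewrite mmult_nat.
Qed.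

Lemma tcolim_presheaf u (p : T P) (z : T (T S)) :
  Tm (fun=> tt) z = eta tt -> xi (Tm (fun s => tcolim u (p, s)) z) <=V tcolim u (p, mu z).
Proof.
move=> zpt; rewrite (mmapM (tcolim u) (fun s => (p, s))).
apply: tcolim_le => q; rewrite -!mmapM mmap1.
rewrite (mmap_eta_pt (y := p)) // zpt munit_nat mmult_unitl => qp qz.
by apply: sup_ub; exists q => //; rewrite /= qp qz.
Qed.

Definition tcolimP u (p : T P) : P := exist _ _ (@tcolim_presheaf u p).

(** The formula for meets with tensors reduces to degrees u' and v' with tens u' v'
below the given convergence. Each family p' converges to its colimit tensored with u'
with degree at least u', and the family of these tensored colimits converges to h
with degree at least v'. *)
Lemma presheaf_decomposable : decomposable (presheaf_obj S).
Proof.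
move=> PP h u v; rewrite meet_tens; apply: sup_le => _ [u' [v' [u'u v'v uv ->]]].
pose p := Tm (tcolimP u') PP.
apply: (@le_trans _ _ (tens (ext (@presheaf_str S) PP p `&` u) (presheaf_str p h `&` v))%O);
  last by apply: sup_ub; exists p.
apply: tens_le; rewrite lexI; apply/andP; split=> //.
  rewrite -[X in X <=V _](xi_const u' PP) /p -{2}(mmap1 PP).
  apply: ext_ub => p'; apply/presheaf_strP => q qp.
  by rewrite qtensC; apply: sup_ub; exists q => //; rewrite /= qp.
apply/presheaf_strP => q; rewrite /p => /lift_fst[Q [QP <-]].
have -> : mu (Tm snd (Tm (fun c => (tcolimP u' c.1, c.2)) Q)) = mu (Tm snd Q).
  by rewrite -mmapM.
have evQ : evalP (Tm (fun c => (tcolimP u' c.1, c.2)) Q) = xi (Tm (tcolim u') Q).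
  by rewrite /evalP -mmapM; congr (xi (Tm _ Q)); apply: funext => -[].
rewrite evQ qhomP; apply: tcolim_le => r r1 r2; rewrite -qhomP -r2.
rewrite qtensC -qtensA qtensC; move: r1; rewrite QP => r1.
exact: (presheaf_strP _ _ _).1 uv r r1.
Qed.

End Decomposable.

Hypothesis can_ext : forall (X X' Y Y' : Type) (r : vrel V X X') (s : vrel V Y Y'),
  vcomp K (vgraph K (@can T X' Y')) (ext (vmeet r s))
  = vcomp K (vmeet (ext r) (ext s)) (vgraph K (@can T X Y)).

(** The hypothesis on the comparison maps, evaluated at one pair of elements: a meet of
extended relations is a supremum over joint elements w'. *)
Lemma meet_ext_le (X X' Y Y' : Type) (r : vrel V X X') (s : vrel V Y Y')
    (w : T (X * Y)) (x : T X') (y : T Y') z :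
  (forall w', Tm fst w' = x -> Tm snd w' = y -> ext (vmeet r s) w w' <=V z) ->
  (ext r (Tm fst w) x `&` ext s (Tm snd w) y)%O <=V z.
Proof.
move=> H; set u := (X in X <=V _).
apply: (@le_trans _ _ (vcomp K (vmeet (ext r) (ext s)) (vgraph K (@can T X Y)) w (x, y))).
  apply: sup_ub; exists (can w) => //; rewrite /vgraph asboolT // qtens1.
  by [].
rewrite -can_ext; apply: sup_le => _ [w' _ <-]; rewrite /vgraph.
case: asboolP => [[w'x w'y] | _]; first by rewrite tens1r; apply: H.
by rewrite qhomP; apply: le0x.
Qed.

Section Exponential.
Variables (X Y : TVobj) (Xdec : decomposable X).

(** The functors to Y from the cartesian product of X with the tensor unit, whose
structure is k at the pure point and bottom elsewhere. *)
Definition expo := {h : X -> Y | forall (t : T X) x, Tm (fun=> tt) t = eta tt ->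
  (k `&` TVstr t x)%O <=V TVstr (Tm h t) (h x)}.

Definition expo_ev (c : expo * X) : Y := sval c.1 c.2.

(** The largest structure for which evaluation is a functor on the cartesian product. *)
Definition expo_str : vrel V (T expo) expo := fun p h =>
  sup [set v | forall q : T (expo * X), Tm fst q = p -> forall x,
    (TVstr (Tm snd q) x `&` v)%O <=V TVstr (Tm expo_ev q) (sval h x)].

Lemma expo_strP v (p : T expo) (h : expo) : v <=V expo_str p h <->
  forall q : T (expo * X), Tm fst q = p -> forall x,
    (TVstr (Tm snd q) x `&` v)%O <=V TVstr (Tm expo_ev q) (sval h x).
Proof.
split=> [vph q qp x | H]; last exact: sup_ub.
apply: (@le_trans _ _ (TVstr (Tm snd q) x `&` expo_str p h)%O).
  by rewrite leI2.
by apply: meet_sup_le => w; apply.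
Qed.

Lemma expo_str_eval (q : T (expo * X)) (h : expo) x :
  (expo_str (Tm fst q) h `&` TVstr (Tm snd q) x)%O
  <=V TVstr (Tm expo_ev q) (sval h x).
Proof. by rewrite meetC; apply: (expo_strP _ _ _).1. Qed.

(** Decomposability of X provides an intermediate t between the two convergences in
X, and the compatibility of ext with meets joins t and p into a single element of
T (expo * X), on which the transitivity of Y can be used. *)
Lemma expo_category : TV_category K xi expo_str.
Proof.
split=> [h | PP p h].
  apply/expo_strP => q qh x; have [t [tpt tq]] := lift_fst_eta qh.
  by rewrite -tq -!mmapM mmap1 meetC; apply: (svalP h).
apply/expo_strP => q /lift_mult[Q [<- QP]] x.
rewrite [Tm snd (mu Q)]mmult_nat.
apply: le_trans (Xdec _ _ _ _) _; apply: sup_le => _ [t _ <-].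
pose cn (q' : T (expo * X)) := (Tm fst q', Tm snd q').
have PPE : Tm fst (Tm cn Q) = PP by rewrite -mmapM.
have ttE : Tm snd (Tm cn Q) = Tm (Tm snd) Q by rewrite -mmapM.
rewrite qtensC qhomP meetC -PPE -ttE; apply: meet_ext_le => w <- <-.
rewrite -qhomP qtensC mmult_nat.
apply: le_trans (TV_trans (TVstrP Y) _ (Tm expo_ev w) _); apply: tens_le.
  apply: ext_le => v /lift_fst[r [<- <-]] <-; rewrite -!mmapM.
  apply: (ext_ub (f := fun c => Tm expo_ev c.1) (g := fun c => expo_ev c.2)).
  by move=> [q' [h' x']]; apply: expo_str_eval.
by rewrite meetC; apply: expo_str_eval.
Qed.

Definition expo_obj : TVobj := TVObj expo_category.

Lemma expo_transpose (Z : TVobj) (f : TVhom (TVprod Z X) Y) :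
  exists g : TVhom Z expo_obj, forall z x, sval (g z) x = f (z, x).
Proof.
have fp z (t : T X) x : Tm (fun=> tt) t = eta tt ->
    (k `&` TVstr t x)%O <=V TVstr (Tm (fun x => f (z, x)) t) (f (z, x)).
  move=> tpt; have := TVfunP f (Tm (fun x => (z, x)) t) (z, x).
  rewrite /= -!mmapM mmap1; apply: le_trans; rewrite leI2 //.
  rewrite (mmap_eta_pt (y := z)) // tpt munit_nat; exact: (TV_refl (TVstrP Z)).
pose g z : expo := exist _ (fun x => f (z, x)) (fp z).
have gP : TV_functor (TVstr (t := Z)) (TVstr (t := expo_obj)) g.
  move=> t z; apply/expo_strP => q /lift_fst[r [<- <-]] x.
  have := TVfunP f r (z, x); rewrite /= -!mmapM meetC.
  by rewrite (_ : (fun c => expo_ev _) = f) //; apply: funext => -[].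
by exists (TVHom gP).
Qed.

End Exponential.

(** A functor from U x X to Y extends along the Yoneda functor of X to one from U times
presheaves on X to presheaves on Y, which transposes. The restriction to X is part of
the data of a point of W because the Yoneda functor of Y may fail to be injective. *)
Lemma TVCat_weak_exponentials : weak_exponentials TVproducts.
Proof.
move=> X Y; have [yX yXff] := yoneda_exists X; have [yY yYff] := yoneda_exists Y.
pose Xdec := presheaf_decomposable (S := X).
pose E := expo_obj (presheaf_obj Y) Xdec.
pose W := {c : E * (X -> Y) | forall x, yY (c.2 x) = sval c.1 (yX x)}.
pose i (c : W) : E := (sval c).1.
pose Z := TVinitial i.
pose ev (c : TVprod Z X) : Y := (sval c.1).2 c.2.
have evP : TV_functor (TVstr (t := TVprod Z X)) (TVstr (t := Y)) ev.
  move=> t c; apply: le_trans (yYff _ _).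
  have evE (c' : TVprod Z X) : yY (ev c') = expo_ev (i c'.1, yX c'.2).
    by case: c' => -[[h g] hg] x; apply: hg.
  rewrite -mmapM (_ : (fun c => yY (ev c)) = fun c => expo_ev (i c.1, yX c.2)); last exact: funext.
  rewrite evE (mmapM (@expo_ev _ _) (fun c : TVprod Z X => (i c.1, yX c.2))).
  apply: le_trans (expo_str_eval _ _ _); rewrite -!mmapM /= leI2 //.
    by rewrite -mmapM.
  rewrite (mmapM yX snd); exact: (TVfunP yX).
exists Z, (TVHom evP : TVhom (TVprod Z X) Y) => U f.
pose j : TVhom (TVprod U X) (TVprod U (presheaf_obj X)) :=
  TVpair (TVfst U X) (TVcomp yX (TVsnd U X)).
have jff t a : TVstr (Tm j t) (j a) <=V TVstr t a.
  rewrite /= -!mmapM leI2 //.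
  by rewrite (mmapM yX snd); apply: yXff.
have [F FE] := presheaf_injective (TVcomp yY f : TVhom (TVprod U X) _) jff.
have [g gE] := expo_transpose Xdec F.
have hP u x : yY (f (u, x)) = sval (g u) (yX x) by rewrite gE; apply: esym (FE (u, x)).
pose h u : W := exist _ (g u, fun x => f (u, x)) (hP u).
have hTV : TV_functor (TVstr (t := U)) (TVstr (t := Z)) h.
  exact: (@TVinitial_lift W E U i h g).
exists (TVHom hTV : TVhom U Z); apply: TVhom_ext => -[u x].
by [].
Qed.

End TV.

Theorem mainTheorem5 (d : Order.disp_t) (V : tbLatticeType d) (K : quantale V)
  (V_heyting : heyting_algebra V)
  (T : monad) (T_nontrivial : nontrivial_monad T)
  (T_wpb : preserves_weak_pullbacks T) (m_wpb : mult_weakly_cartesian T)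
  (xi : T V -> V) (xi_theory : strict_topological_theory K xi)
  (can_ext : forall (X X' Y Y' : Type) (r : vrel V X X') (s : vrel V Y Y'),
     vcomp K (vgraph K (@can T X' Y')) (vext K xi (vmeet r s))
     = vcomp K (vmeet (vext K xi r) (vext K xi s)) (vgraph K (@can T X Y)))
  (meet_tens : forall u v w : V,
     (w `&` qtens K u v)%O
     = qsup K [set z | exists u' v' : V,
                 [/\ (u' <= u)%O, (v' <= v)%O, (qtens K u' v' <= w)%O
                   & z = qtens K u' v']])
  (ext_scale : forall (X Y : Type) (a : vrel V X Y) (u : V),
     vext K xi (vscale K a u) = vscale K (vext K xi a) u)
  (tens_functor : TV_functor (TV_tensor K (hom_xi K xi) (hom_xi K xi))
                    (hom_xi K xi) (fun p : V * V => qtens K p.1 p.2))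
  (pair_functor : forall (X : Type) (a : vrel V (T X) X), TV_category K xi a ->
     forall u : V, TV_functor a (TV_tensor K a (hom_xi K xi))
                     (fun x : X => (x, u))) :
  (exists (E : category) (J : functor (TVCat K xi) E), is_exact_completion J) /\
  (forall (E : category) (J : functor (TVCat K xi) E),
     is_exact_completion J -> cartesian_closed E).
Proof.
have Clex := TVCat_finitely_complete xi_theory; split.
  by exists (Cex (TVCat K xi)), disc; apply: Cex_exact_completion.
apply: exact_completion_cartesian_closed Clex _ _.
  exact: TVCat_weak_exponentials.
exact: TVCat_universal_equalizers.
Qed.
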